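(* Let $s\in\{1,2,3,\dots\}$ be fixed, and consider a sample of $n=(s+1)k-1$ independent observations on a random variable $X$ with absolutely continuous c.d.f. $F$ and p.d.f. $f=F'$. Suppose that $c_{F,s}:=f\left[F^{\leftarrow}\left(\frac1{s+1}\right)\right]\in(0,\infty)$ and $d_{F,s}:=f\left[F^{\leftarrow}\left(\frac s{s+1}\right)\right]\in(0,\infty)$ exist. Then $$\lim_{k\to\infty}E\,L_n\left(F,\tfrac1{s+1}\right)=L\left(F,\tfrac1{s+1}\right),\qquad\lim_{k\to\infty}E\,R_n\left(F,\tfrac1{s+1}\right)=R\left(F,\tfrac1{s+1}\right),$$ and for $k\to\infty$ $$\sqrt{(s+1)k-1}\left(L_n\left(F,\tfrac1{s+1}\right)-L\left(F,\tfrac1{s+1}\right)\right)\stackrel{d}{\to}N(0;V_{L,F,s}),$$ $$\sqrt{(s+1)k-1}\left(R_n\left(F,\tfrac1{s+1}\right)-R\left(F,\tfrac1{s+1}\right)\right)\stackrel{d}{\to}N(0;V_{R,F,s}),$$ where $N(0;V)$ is the normal law with mean $0$ and variance $V$, and $$V_{L,F,s}=\frac{s}{(s+1)^2}\left[\frac{(s+1)^2}{c_{F,s}^2}-\frac{2(s+1)}{c_{F,s}d_{F,s}}+\frac{s^2}{d_{F,s}^2}\right],$$ $$V_{R,F,s}=\frac{s}{(s+1)^2}\left[\frac{s^2}{c_{F,s}^2}-\frac{2(s+1)}{c_{F,s}d_{F,s}}+\frac{(s+1)^2}{d_{F,s}^2}\right].$$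
   Context: For an absolutely continuous c.d.f. $F$ and $q\in[0,1]$, the quantile function is $F^{\leftarrow}(q)=\inf\{x\in\mathbb R:F(x)\ge q\}=\sup\{x\in\mathbb R:F(x)\le q\}$ (the equality of the two expressions is part of the convention). For $p\in(0,0.5]$ the theoretical fences are $$R(F,p)=\tfrac1pF^{\leftarrow}(1-p)-\tfrac{1-p}{p}F^{\leftarrow}(p),\qquad L(F,p)=\tfrac1pF^{\leftarrow}(p)-\tfrac{1-p}{p}F^{\leftarrow}(1-p).$$ For a sample $X_1,\dots,X_n$ with order statistics $X_{(1,n)}\le\dots\le X_{(n,n)}$, the empirical $q$-quantile is $F_n^{\leftarrow}(q)=X_{([(n+1)q],n)}$ for $q\in[\frac1{n+1},\frac n{n+1}]$, where $[a]$ is the integer part of $a$. The empirical fences are $$R_n(F,p)=\tfrac1pF_n^{\leftarrow}(1-p)-\tfrac{1-p}{p}F_n^{\leftarrow}(p),\qquad L_n(F,p)=\tfrac1pF_n^{\leftarrow}(p)-\tfrac{1-p}{p}F_n^{\leftarrow}(1-p).$$ Thus for $n=(s+1)k-1$ and $p=\frac1{s+1}$: $L_n=(s+1)X_{(k,n)}-sX_{(sk,n)}$ and $R_n=(s+1)X_{(sk,n)}-sX_{(k,n)}$.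
   Formalization: Each limit of expectations is stated under the added condition that L_n (resp. R_n) has a finite expectation for all large k; without it the claim fails, e.g. for F(x)=1-1/log x, x≥e, s=1, where E L_n is infinite for every k. *)

(* Defs.v *)
From HB Require Import structures.
From mathcomp Require Import all_boot all_order all_algebra finmap.
From mathcomp Require Import all_classical all_reals all_analysis.

Set Implicit Arguments.
Unset Strict Implicit.
Unset Printing Implicit Defensive.

Import Order.TTheory GRing.Theory Num.Theory.
Import numFieldNormedType.Exports.

Local Open Scope classical_set_scope.
Local Open Scope ring_scope.

Section Quantiles.
Context {R : realType}.
Implicit Types (F f : R -> R) (p q c d : R).

(* F is absolutely continuous with density f.  A density is determined by F
   only almost everywhere; the last clause fixes the version f = F' at every
   point where F is differentiable, so that the value of f there is
   meaningful. *)
Definition is_pdf F f :=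
  [/\ measurable_fun setT f,
      forall x, 0 <= f x,
      forall x, (F x)%:E
        = (\int[lebesgue_measure]_(t in `]-oo, x]) (f t)%:E)%E
    & forall x, derivable F x 1 -> F^`()%classic x = f x].

(* This agrees with sup [set x | F x <= q] wherever F has a positive
   derivative at the quantile: see quantile_supE. *)
Definition quantile F q : R := inf [set x | q <= F x].

Lemma quantile_supE F q :
  {homo F : x y / x <= y} -> has_inf [set x | q <= F x] ->
  derivable F (quantile F q) 1 -> 0 < F^`()%classic (quantile F q) ->
  quantile F q = sup [set x | F x <= q].
Proof.
move=> ndF hF; set x0 := quantile F q => dF F'_gt0.
have cF : F x @[x --> x0] --> F x0.
  by apply: differentiable_continuous; apply/derivable1_diffP.
have ltF x : x < x0 -> F x < q.
  move=> xx0; rewrite ltNge; apply/negP => qFx.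
  by move: xx0; rewrite ltNge => /negP; apply; apply: ge_inf => //; case: hF.
have gtF x : x0 < x -> q <= F x.
  move=> x0x; have [|y qFy yx] := @inf_adherent _ _ (x - x0) _ hF.
    by rewrite subr_gt0.
  apply: (le_trans qFy); apply: ndF; apply: ltW.
  by move: yx; rewrite -/(quantile F q) -/x0 addrC subrK.
have Fx0 : F x0 = q.
  apply/eqP; rewrite eq_le; apply/andP; split.
    apply: (cvgr_to_le (cvg_at_left_filter cF)).
    by near=> x; apply: ltW; apply: ltF; near: x; exact: nbhs_left_lt.
  apply: (cvgr_to_ge (cvg_at_right_filter cF)).
  by near=> x; apply: gtF; near: x; exact: nbhs_right_gt.
have gtF' x : x0 < x -> q < F x.
  move=> x0x; rewrite lt_neqAle gtF// andbT; apply/eqP => qE.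
  move: F'_gt0; rewrite derive1E; suff -> : 'D_1 F x0 = 0 by rewrite ltxx.
  apply: cvg_unique (cvg_dnbhs_at_right dF) _ => //.
  apply: cvg_near_cst; near=> h.
  have h0 : 0 < h by near: h; exact: nbhs_right_gt.
  have hx : h < x - x0 by near: h; apply: nbhs_right_lt; rewrite subr_gt0.
  rewrite /= [h%:A]mulr1; suff -> : F (h + x0) = F x0 by rewrite subrr scaler0.
  apply/eqP; rewrite eq_le; apply/andP; split.
    by rewrite Fx0 qE; apply: ndF; rewrite -lerBrDr ltW.
  by apply: ndF; rewrite lerDr ltW.
apply/eqP; rewrite eq_le; apply/andP; split.
  apply: ub_le_sup; last by rewrite /= Fx0.
  by exists x0 => x /= Fxq; rewrite leNgt; apply/negP => /gtF'; rewrite ltNge Fxq.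
apply: ge_sup; first by exists x0; rewrite /= Fx0.
by move=> x /= Fxq; rewrite leNgt; apply/negP => /gtF'; rewrite ltNge Fxq.
Unshelve. all: by end_near. Qed.

Definition lfence F p :=
  p^-1 * quantile F p - (1 - p) / p * quantile F (1 - p).

Definition rfence F p :=
  p^-1 * quantile F (1 - p) - (1 - p) / p * quantile F p.

End Quantiles.

Section Sample.
Context {R : realType} d {T : measurableType d} {P : probability T R}.
Implicit Types (X : nat -> {RV P >-> R}).

Definition mutually_independent X :=
  forall (J : {fset nat}) (B : nat -> set R), (forall i, measurable (B i)) ->
    P (\bigcap_(i in [set` J]) (X i @^-1` B i))
    = (\prod_(i <- J) P (X i @^-1` B i))%E.

(* The sample X_1, ..., X_n is X 0, ..., X n.-1 and j is counted from 1. *)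
Definition order_stat X n j (w : T) : R :=
  nth 0 (sort <=%R [seq X i w | i <- iota 0 n]) j.-1.

Definition emp_quantile X n (q : R) : T -> R :=
  order_stat X n (Num.truncn (n.+1%:R * q)).

Definition emp_lfence X n (p : R) (w : T) : R :=
  p^-1 * emp_quantile X n p w - (1 - p) / p * emp_quantile X n (1 - p) w.

Definition emp_rfence X n (p : R) (w : T) : R :=
  p^-1 * emp_quantile X n (1 - p) w - (1 - p) / p * emp_quantile X n p w.

Definition cvg_in_law (Y : nat -> T -> R)
    (mu : probability (measurableTypeR R) R) :=
  forall x : R, {for x, continuous (fun y : R => mu `]-oo, y]%classic)} ->
    P [set w | Y k w <= x] @[k --> \oo] --> mu `]-oo, x]%classic.

End Sample.

(* normal_prob takes the standard deviation, here it is the variance. *)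
Definition gaussian {R : realType} (m V : R) : probability _ R :=
  normal_prob m (Num.sqrt V).

Section Variances.
Context {R : realType}.
Variables (s : nat) (c d : R).

Definition lfence_var : R :=
  s%:R / s.+1%:R ^+ 2 * (s.+1%:R ^+ 2 / c ^+ 2
    - 2 * s.+1%:R / (c * d) + s%:R ^+ 2 / d ^+ 2).

Definition rfence_var : R :=
  s%:R / s.+1%:R ^+ 2 * (s%:R ^+ 2 / c ^+ 2
    - 2 * s.+1%:R / (c * d) + s.+1%:R ^+ 2 / d ^+ 2).

End Variances.

(* Main.v *)
(* Both fences are linear combinations al Z + be Y of two order statistics.

   Law.  By Ghosh's argument, sqrt n (Z - z) differs from the normalized count
   sum_i (F z - [X_i <= z]) / (F'(z) sqrt n) by a term vanishing in probability:
   [Z <= u] is an event about the count of the X_i below u, and near z the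
   increments of the centered counts are negligible by Chebyshev's inequality.
   Hence a combination of two order statistics is equivalent to a normalized sum
   of independent variables with finitely many values.  Its law is an iterated
   averaging operator, which is compared step by step with the heat flow of a
   Gaussian-smoothed indicator; this flow is explicit in terms of the normal
   distribution function Phi.

   Means.  Integrability of a single fence forces the tails of F to decay
   polynomially, by Markov's inequality.  An exponential bound for the counts then
   gives tails O(t^-2) uniformly in k, and dominated convergence in the layer-cake
   formula turns consistency of the sample quantiles into convergence of means. *)

Require Import Defs.
From HB Require Import structures.
From mathcomp Require Import all_boot all_order all_algebra finmap.
From mathcomp Require Import all_classical all_reals all_analysis.
From mathcomp Require Import measurable_realfun.
From mathcomp Require Import ring lra zify.

Set Implicit Arguments.
Unset Strict Implicit.
Unset Printing Implicit Defensive.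

Import Order.TTheory GRing.Theory Num.Theory.
Import numFieldNormedType.Exports.

Local Open Scope classical_set_scope.
Local Open Scope ring_scope.

(** * The normal distribution function *)

Section Calculus.
Context {R : realType}.
Implicit Types (f g : R -> R) (x y : R).

(** The linearized statistic depends on an observation only through its position relative to two
    thresholds. The law of a sum is thus an iterate of a finite average; independence enters through
    [sample_law_joint] and the factorization in [sample_event_prob], and the central limit theorem
    becomes a deterministic estimate on averaging operators. Means need a separate argument:
    positive densities at two quantiles say nothing about the tails, and [F] may have no moment of
    positive order. The assumed eventual integrability of the fence is the only source of tail
    information. It yields a bound of order [1 / t] for a fixed power of the tails, and larger
    samples raise that power. The case [s = 1] shapes several statements. Both order statistics are
    then the same median, so the limit variance stays positive only because the coefficients do not
    cancel, and separating the two statistics by placing observations far away is impossible. *)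

Lemma MVT_between f (df : R -> R) x y :
  (forall t : R, is_derive t 1 f (df t)) ->
  exists c, [/\ `|c - x| <= `|y - x|, `|c - y| <= `|y - x| &
                f y - f x = df c * (y - x)].
Proof.
move=> fdf.
have cf : continuous f.
  by move=> t; apply/differentiable_continuous/derivable1_diffP.
have [xy|yx] := leP x y.
  have [|c] := @MVT_segment _ f df x y xy (fun t _ => fdf t).
    exact: continuous_subspaceT.
  rewrite in_itv/= => /andP[xc cy] E; exists c; split => //.
    by rewrite !ger0_norm ?subr_ge0// lerD2r.
  by rewrite ler0_norm ?subr_le0// ger0_norm ?subr_ge0//; lra.
have [|c] := @MVT_segment _ f df y x (ltW yx) (fun t _ => fdf t).
  exact: continuous_subspaceT.
rewrite in_itv/= => /andP[yc cx] E; exists c; split.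
- by rewrite ler0_norm ?subr_le0// ltr0_norm ?subr_lt0//; lra.
- by rewrite ger0_norm ?subr_ge0// ltr0_norm ?subr_lt0//; lra.
- by rewrite -opprB E -mulrN opprB.
Qed.

(** Two uses of the mean value theorem lose the factor 1/2 but need the bound [K] only within
    distance [|y - x|] of [x]; [Phi_dilate] relies on this locality. *)
Lemma taylor1_bound f f1 f2 (K x y : R) :
  (forall t : R, is_derive t 1 f (f1 t)) ->
  (forall t : R, is_derive t 1 f1 (f2 t)) ->
  (forall t, `|t - x| <= `|y - x| -> `|f2 t| <= K) ->
  `|f y - f x - f1 x * (y - x)| <= K * (y - x) ^+ 2.
Proof.
move=> df df1 f2K; have [c [cx cy ->]] := MVT_between x y df.
rewrite -mulrBl; have [e [ex ec ->]] := MVT_between x c df1.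
rewrite !normrM -(real_normK (num_real (y - x))) expr2 mulrA.
apply: ler_wpM2r => //; apply: ler_pM => //; apply: f2K.
exact: (le_trans ex).
Qed.

Lemma taylor2_bound f f1 f2 f3 (K x y : R) :
  (forall t : R, is_derive t 1 f (f1 t)) ->
  (forall t : R, is_derive t 1 f1 (f2 t)) ->
  (forall t : R, is_derive t 1 f2 (f3 t)) ->
  (forall t, `|f3 t| <= K) ->
  `|f y - f x - f1 x * (y - x) - f2 x * (y - x) ^+ 2 / 2| <= K * `|y - x| ^+ 3.
Proof.
move=> df df1 df2 f3K.
(* Up to a constant [g] is the second-order remainder of [f]; its derivative [g1] is the first-order
   remainder of [f1], controlled by [taylor1_bound]. *)
pose g t := f t - f1 x * t - f2 x / 2 * (t - x) ^+ 2.
pose g1 t := f1 t - f1 x - f2 x * (t - x).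
have dg (t : R) : is_derive t 1 g (g1 t).
  have := df t => dft; apply: is_derive_eq.
  by rewrite /g1 /GRing.scale /=; field.
have -> : f y - f x - f1 x * (y - x) - f2 x * (y - x) ^+ 2 / 2 = g y - g x.
  by rewrite /g; field.
have [c [cx cy ->]] := MVT_between x y dg.
rewrite normrM exprSr mulrA ler_wpM2r//.
have := @taylor1_bound f1 f2 f3 K x c df1 df2 (fun t _ => f3K t).
move=> /le_trans; apply; rewrite -(real_normK (num_real (c - x))).
apply: ler_wpM2l; first exact: le_trans (f3K 0).
by rewrite ler_sqr ?nnegrE.
Qed.

End Calculus.

Section NormalCdf.
Context {R : realType}.
Implicit Types (s x y : R).

Definition normal_cdf (s x : R) : R := fine (normal_prob 0 s `]-oo, x]).

Lemma normal_cdfE s x : (normal_cdf s x)%:E = normal_prob 0 s `]-oo, x].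
Proof. by rewrite /normal_cdf fineK// fin_num_measure. Qed.

Lemma normal_cdf_ge0 s x : 0 <= normal_cdf s x.
Proof. by rewrite -lee_fin normal_cdfE. Qed.

Lemma normal_cdf_le1 s x : normal_cdf s x <= 1.
Proof. by rewrite -lee_fin normal_cdfE probability_le1. Qed.

Lemma normal_cdf_homo s : {homo normal_cdf s : x y / x <= y}.
Proof.
move=> x y xy; rewrite -lee_fin !normal_cdfE le_measure ?inE//.
by apply: subset_itvl; rewrite bnd_simp.
Qed.

Lemma is_derive_normal_cdf s x : s != 0 ->
  is_derive x 1 (normal_cdf s) (normal_pdf 0 s x).
Proof.
move=> s0; have [|||D E] :=
    @continuous_FTC1 R (normal_pdf 0 s) -oo%O x (x + 1) _ _ (ltNyr _) _.
- by rewrite ltrDl.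
- by apply: integrableS (integrable_normal_pdf 0 s).
- exact: continuous_normal_pdf.
rewrite -E derive1E; exact: derivableP D.
Qed.

(** As a random variable on the line with measure [normal_prob 0 s], the identity has cdf
    [normal_cdf s], so the general limits of cdfs at infinity apply. *)
Let idTR : measurableTypeR R -> R := idfun.

#[local] HB.instance Definition _ :=
  @isMeasurableFun.Build _ _ _ _ idTR (@measurable_id _ _ setT).

Lemma cvg_normal_cdfy s : normal_cdf s x @[x --> +oo] --> (1 : R).
Proof.
have := @cvg_cdfy1 _ _ _ _ (idTR : {RV normal_prob 0 s >-> R}).
exact: fine_cvg.
Qed.

Lemma cvg_normal_cdfNy s : normal_cdf s x @[x --> -oo] --> (0 : R).
Proof.
have := @cvg_cdfNy0 _ _ _ _ (idTR : {RV normal_prob 0 s >-> R}).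
exact: fine_cvg.
Qed.

Definition Phi x := normal_cdf 1 x.
Definition phi x := normal_pdf 0 1 x.

Lemma phiE x : phi x = normal_peak 1 * expR (- (x ^+ 2 / 2)).
Proof.
rewrite /phi normal_pdfE ?oner_neq0// /normal_fun subr0 expr1n.
by rewrite mulNr.
Qed.

Lemma phi_ge0 x : 0 <= phi x. Proof. exact: normal_pdf_ge0. Qed.

Lemma is_derive_Phi x : is_derive x 1 Phi (phi x).
Proof. by apply: is_derive_normal_cdf; rewrite oner_neq0. Qed.

Lemma is_derive_phi x : is_derive x 1 phi (- x * phi x).
Proof.
rewrite (_ : phi = fun x => normal_peak 1 * expR (- (x ^+ 2 / 2))); last first.
  by apply/funext => y; exact: phiE.
by apply: is_derive_eq; rewrite /GRing.scale /=; field.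
Qed.

Lemma is_derive_phi1 x :
  is_derive x 1 (fun x => - x * phi x) ((x ^+ 2 - 1) * phi x).
Proof.
have D := is_derive_phi x.
by apply: is_derive_eq; rewrite /GRing.scale /=; ring.
Qed.

(** The difference of the two sides has derivative zero, hence is constant, and it tends to 0 at
    minus infinity. *)
Lemma normal_cdf_scale s x : 0 < s -> normal_cdf s x = Phi (x / s).
Proof.
move=> s0.
have D (t : R) : is_derive t 1 (fun t => normal_cdf s t - Phi (t / s)) 0.
  have D1 := is_derive_normal_cdf t (lt0r_neq0 s0).
  have D2 : is_derive t 1 (fun t : R => Phi (t / s)) (phi (t / s) * s^-1).
    apply: is_derive1_comp; first exact: is_derive_Phi.
    rewrite (_ : *%R^~ s^-1 = fun u : R => s^-1 * u); last first.
      by apply/funext => u; rewrite mulrC.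
    by apply: is_derive_eq; rewrite /GRing.scale /= mulr1.
  apply: is_derive_eq; rewrite phiE normal_pdfE ?gt_eqF//.
  rewrite /normal_fun subr0 /normal_peak.
  have -> : Num.sqrt (s ^+ 2 * pi *+ 2) = s * Num.sqrt (pi *+ 2).
    by rewrite -mulrnAr sqrtrM ?sqr_ge0// sqrtr_sqr gtr0_norm.
  rewrite expr1n mul1r invfM.
  have -> : - t ^+ 2 / (s ^+ 2 *+ 2) = - ((t / s) ^+ 2 / 2).
    by field; rewrite gt_eqF.
  by ring.
have C y : normal_cdf s x - Phi (x / s) = normal_cdf s y - Phi (y / s).
  exact: (is_derive_0_is_cst x y D).
apply/eqP; rewrite -subr_eq0; apply/eqP.
have : (fun y => normal_cdf s y - Phi (y / s)) y @[y --> -oo] --> (0 - 0 : R).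
  apply: cvgB; first exact: cvg_normal_cdfNy.
  apply: (cvg_comp _ Phi _ (cvg_normal_cdfNy 1)).
  by apply/gt0_cvgMlNy; [rewrite invr_gt0|exact: cvg_id].
rewrite subrr => h; apply: cvg_unique h => //.
by apply: cvg_near_cst; near=> y; rewrite -C.
Unshelve. all: by end_near. Qed.

(** Squaring [1 + x ^+ 2 / 4 <= expR (x ^+ 2 / 4)] gives [x ^+ 4 / 16 <= expR (x ^+ 2 / 2)]. *)
Lemma gauss_tail x : x ^+ 4 * phi x <= 16 * normal_peak 1.
Proof.
have peak0 : 0 <= normal_peak 1 :> R by exact: normal_peak_ge0.
rewrite phiE expRN; set e := expR (x ^+ 2 / 2).
have e0 : 0 < e by exact: expR_gt0.
rewrite mulrCA mulrC ler_wpM2r// ler_pdivrMr//.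
have : 1 + x ^+ 2 / 4 <= expR (x ^+ 2 / 4) by exact: expR_ge1Dx.
have -> : e = expR (x ^+ 2 / 4) ^+ 2.
  by rewrite -expRM_natl; congr expR; field.
set h := expR _ => hx.
have x2 : 0 <= x ^+ 2 by rewrite sqr_ge0.
have : (1 + x ^+ 2 / 4) ^+ 2 <= h ^+ 2.
  by rewrite ler_sqr ?nnegrE ?expR_ge0// addr_ge0// divr_ge0.
have -> : x ^+ 4 = (x ^+ 2) ^+ 2 by rewrite -exprM.
by move: (x ^+ 2) x2 (h ^+ 2) => t t0 u; nra.
Qed.

(** Here 18 is 2 + 16: the polynomials multiplying [phi] below are dominated by [2 + x ^+ 4], and
    [gauss_tail] contributes 16. *)
Definition phi_bound : R := 18 * normal_peak 1.

Lemma phi_bound_ge0 : 0 <= phi_bound.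
Proof. by rewrite mulr_ge0// normal_peak_ge0. Qed.

Lemma phi_moment_bound (q : R -> R) x :
  `|q x| <= 2 + x ^+ 4 -> `|q x| * phi x <= phi_bound.
Proof.
move=> qx; apply: (@le_trans _ _ ((2 + x ^+ 4) * phi x)).
  by rewrite ler_wpM2r// phi_ge0.
have := gauss_tail x.
have : phi x <= normal_peak 1 by apply: normal_pdf_ub; rewrite oner_neq0.
by rewrite /phi_bound mulrDl; lra.
Qed.

Lemma phi1_bound x : `|- x * phi x| <= phi_bound.
Proof.
rewrite normrM (ger0_norm (phi_ge0 x)).
apply: (@phi_moment_bound (fun x => - x)); rewrite normrN.
rewrite (_ : x ^+ 4 = `|x| ^+ 4); last by rewrite -normrX ger0_norm// exprn_even_ge0.
have := normr_ge0 x; move: `|x| => t t0.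
by have := sqr_ge0 (t ^+ 2 - 1); have := sqr_ge0 (t - 1); nra.
Qed.

Lemma phi2_bound x : `|(x ^+ 2 - 1) * phi x| <= phi_bound.
Proof.
rewrite normrM (ger0_norm (phi_ge0 x)).
apply: (@phi_moment_bound (fun x => x ^+ 2 - 1)).
rewrite ler_norml; have -> : x ^+ 4 = (x ^+ 2) ^+ 2 by rewrite -exprM.
have := sqr_ge0 x; move: (x ^+ 2) => t t0.
by apply/andP; split; nra.
Qed.

Lemma phi3_bound x : `|x ^+ 3 * phi x| <= phi_bound.
Proof.
rewrite normrM (ger0_norm (phi_ge0 x)).
apply: (@phi_moment_bound (fun x => x ^+ 3)); rewrite normrX.
rewrite (_ : x ^+ 4 = `|x| ^+ 4); last by rewrite -normrX ger0_norm// exprn_even_ge0.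
have := normr_ge0 x; move: `|x| => t t0.
have := sqr_ge0 (t ^+ 2 - t); have := sqr_ge0 (t - 1); have := sqr_ge0 (t ^+ 2 - 1).
by have := mulr_ge0 t0 (sqr_ge0 (t - 1)); nra.
Qed.

Lemma Phi_taylor2 x h :
  `|Phi (x + h) - Phi x - phi x * h + x * phi x * h ^+ 2 / 2|
    <= phi_bound * `|h| ^+ 3.
Proof.
have := @taylor2_bound _ Phi phi (fun x => - x * phi x)
  (fun x => (x ^+ 2 - 1) * phi x) phi_bound x (x + h)
  is_derive_Phi is_derive_phi is_derive_phi1 phi2_bound.
by rewrite (addrC x h) addrK !mulNr opprK.
Qed.

(** Taylor expansion in the dilation factor around 1. The bound is uniform in [x] because [phi]
    absorbs the powers of [x] produced by differentiating. *)
Lemma Phi_dilate (r x : R) : 2^-1 <= r <= 1 ->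
  `|Phi (r * x) - Phi x - x * phi x * (r - 1)| <= 4 * phi_bound * (r - 1) ^+ 2.
Proof.
move=> /andP[r2 r1].
have D1 (t : R) : is_derive t 1 (fun t => Phi (t * x)) (x * phi (t * x)).
  rewrite [x * _]mulrC.
  rewrite (_ : (fun t => Phi (t * x)) = Phi \o (fun t => x * t)); last first.
    by apply/funext => u /=; rewrite mulrC.
  rewrite (mulrC t); apply: is_derive1_comp; first exact: is_derive_Phi.
  by apply: is_derive_eq; rewrite /GRing.scale /= mulr1.
have D2 (t : R) : is_derive t 1 (fun t => x * phi (t * x))
    (x * (- (t * x) * phi (t * x) * x)).
  apply: is_deriveZ.
  rewrite (_ : (fun t => phi (t * x)) = phi \o (fun t => x * t)); last first.
    by apply/funext => u /=; rewrite mulrC.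
  rewrite (mulrC t); apply: is_derive1_comp; first exact: is_derive_phi.
  by apply: is_derive_eq; rewrite /GRing.scale /= mulr1.
have := @taylor1_bound _ (fun t => Phi (t * x)) (fun t => x * phi (t * x)) _
  (4 * phi_bound) 1 r D1 D2.
rewrite !mul1r; apply => t.
rewrite (ler0_norm (_ : r - 1 <= 0)) ?subr_le0// => tr.
have t0 : 2^-1 <= t by move: tr; rewrite ler_norml => /andP[]; lra.
have tp : 0 < t by lra.
(* The second derivative in [t] is a multiple of [y ^+ 3 * phi y] at [y = t * x]; the factor
   [t ^- 2] is at most 4 since [t >= 1/2]. *)
rewrite (_ : x * _ = - ((t ^- 2) * ((t * x) ^+ 3 * phi (t * x)))); last first.
  by field; rewrite gt_eqF.
rewrite normrN normrM ler_pM ?phi3_bound// ger0_norm ?invr_ge0 ?exprn_ge0 ?(ltW tp)//.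
by rewrite invf_ple ?posrE ?exprn_gt0//; nra.
Qed.

End NormalCdf.

(** * Averaging operators and the central limit theorem *)

Section Averaging.
Context {R : realType} {I : finType}.
Variables (p : I -> R) (a : I -> R).
Implicit Types (g h : R -> R) (x : R).

(** The transition operator of a random walk with steps [a i] of probability [p i]; its iterates
    express laws of sums without a product measure. *)
Definition avg g x : R := \sum_i p i * g (x + a i).

Hypothesis p_ge0 : forall i, 0 <= p i.
Hypothesis p_sum1 : \sum_i p i = 1.

Lemma le_avg g h : (forall x, g x <= h x) -> forall x, avg g x <= avg h x.
Proof. by move=> gh x; apply: ler_sum => i _; exact: ler_wpM2l. Qed.

Lemma le_iter_avg n g h :
  (forall x, g x <= h x) -> forall x, iter n avg g x <= iter n avg h x.
Proof. by elim: n => // n IH gh x; exact: le_avg (IH gh) x. Qed.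

Lemma avgD g h x : avg (fun y => g y + h y) x = avg g x + avg h x.
Proof. by rewrite /avg -big_split; apply: eq_bigr => i _; rewrite mulrDr. Qed.

Lemma avgZ c g x : avg (fun y => c * g y) x = c * avg g x.
Proof. by rewrite /avg mulr_sumr; apply: eq_bigr => i _; rewrite mulrCA. Qed.

Lemma avg_cst c x : avg (fun=> c) x = c.
Proof. by rewrite /avg -mulr_suml p_sum1 mul1r. Qed.

Lemma iter_avgD n g h x :
  iter n avg (fun y => g y + h y) x = iter n avg g x + iter n avg h x.
Proof.
elim: n x => // n IH x; rewrite !iterS -avgD.
by congr avg; apply/funext => y; exact: IH.
Qed.

Lemma iter_avgZ n c g x :
  iter n avg (fun y => c * g y) x = c * iter n avg g x.
Proof.
elim: n x => // n IH x; rewrite !iterS -avgZ.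
by congr avg; apply/funext => y; exact: IH.
Qed.

Lemma iter_avg_cst n c x : iter n avg (fun=> c) x = c.
Proof.
elim: n x => // n IH x; rewrite iterS -[RHS](avg_cst c x).
by congr avg; apply/funext => y; exact: IH.
Qed.

Lemma iter_avg_bound n g c :
  (forall x, `|g x| <= c) -> forall x, `|iter n avg g x| <= c.
Proof.
move=> gc x; rewrite ler_norml; apply/andP; split.
  rewrite -[X in X <= _](iter_avg_cst n _ x); apply: le_iter_avg => y.
  by have := gc y; rewrite ler_norml => /andP[].
rewrite -[X in _ <= X](iter_avg_cst n _ x); apply: le_iter_avg => y.
by have := gc y; rewrite ler_norml => /andP[].
Qed.

(* Averages are contractions, so the errors of the single steps add up. *)
Lemma iter_avg_telescope (u : nat -> R -> R) n (c : R) :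
  (forall j x, (j < n)%N -> `|avg (u j) x - u j.+1 x| <= c) ->
  forall x, `|iter n avg (u 0) x - u n x| <= n%:R * c.
Proof.
elim: n u => [|n IH] u uc x; first by rewrite subrr normr0 mul0r.
(* The first summand is the one-step error [avg (u 0) - u 1] averaged [n] times; the second is the
   induction hypothesis for the shifted family. *)
have -> : iter n.+1 avg (u 0) x - u n.+1 x =
    (iter n avg (fun y => avg (u 0) y + -1 * u 1 y) x)
    + (iter n avg (u 1) x - u n.+1 x).
  rewrite iter_avgD iter_avgZ iterSr.
  by ring.
rewrite (le_trans (ler_normD _ _))// -natr1 mulrDl mul1r addrC lerD//.
  by apply: (IH (fun j => u j.+1)) => j y jn; exact: uc.
by apply: iter_avg_bound => y; rewrite mulN1r; exact: uc.
Qed.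

Definition mean := \sum_i p i * a i.
Definition mom2 := \sum_i p i * a i ^+ 2.

Lemma iter_avg_sqr n x : mean = 0 ->
  iter n avg (fun y => y ^+ 2) x = x ^+ 2 + n%:R * mom2.
Proof.
move=> a0; elim: n x => [|n IH] x; first by rewrite mul0r addr0.
rewrite iterS (_ : iter n _ _ = fun y => y ^+ 2 + n%:R * mom2); last first.
  by apply/funext => y; exact: IH.
rewrite avgD avg_cst -natr1 mulrDl mul1r addrA addrAC; congr (_ + _).
rewrite /avg; under eq_bigr do rewrite sqrrD !mulrDr.
rewrite !big_split/= -mulr_suml p_sum1 mul1r; congr (_ + _).
have E : \sum_i p i * (x * a i) = 0.
  transitivity (x * mean); last by rewrite a0 mulr0.
  by rewrite mulr_sumr; apply: eq_bigr => i _; rewrite mulrCA.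
by rewrite E !addr0.
Qed.

Lemma iter_avg_chebyshev n (t : R) : 0 < t -> mean = 0 ->
  iter n avg (fun y => (t <= `|y|)%R%:R) 0 <= n%:R * mom2 / t ^+ 2.
Proof.
move=> t0 a0.
apply: (@le_trans _ _ (iter n avg (fun y => t ^- 2 * y ^+ 2) 0)).
  apply: le_iter_avg => y; case: (leP t `|y|) => [ty|_]; last first.
    by rewrite mulr_ge0// ?sqr_ge0// invr_ge0 sqr_ge0.
  rewrite mulrC ler_pdivlMr ?exprn_gt0// mul1r -(real_normK (num_real y)).
  by rewrite ler_sqr ?nnegrE// ltW.
by rewrite iter_avgZ iter_avg_sqr// expr0n add0r mulrC.
Qed.

(** Exponentials are eigenfunctions of [avg]; the eigenvalue is the moment generating function of
    one step. *)
Lemma iter_avg_exp n (l : R) x :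
  iter n avg (fun y => expR (l * y)) x
  = expR (l * x) * (\sum_i p i * expR (l * a i)) ^+ n.
Proof.
elim: n x => [|n IH] x; first by rewrite expr0 mulr1.
rewrite iterS; set c := \sum_i _.
rewrite (_ : iter n _ _ = fun y => c ^+ n * expR (l * y)); last first.
  by apply/funext => y; rewrite IH mulrC.
rewrite avgZ exprSr [RHS]mulrCA; congr (_ * _).
rewrite /c mulr_sumr; apply: eq_bigr => i _.
by rewrite mulrDr expRD mulrCA.
Qed.

End Averaging.

(** * The central limit theorem for smoothed indicators *)

Section CLT.
Context {R : realType} {I : finType}.
Implicit Types (p a xi : I -> R).

(** With [r] the inverse root of [1 + v], [Phi_dilate] costs [4 * phi_bound * v ^+ 2] since
    [1 - r <= v], and replacing [1 - r] by [v / 2] costs one more [phi_bound * v ^+ 2]. *)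
Lemma Phi_rescale (y v : R) : 0 <= v <= 1 ->
  `|Phi (y / Num.sqrt (1 + v)) - Phi y + y * phi y * v / 2|
    <= 5 * phi_bound * v ^+ 2.
Proof.
move=> /andP[v0 v1].
set r : R := (Num.sqrt (1 + v))^-1; rewrite [y / _]mulrC -/r.
have r0 : 0 < r by rewrite invr_gt0 sqrtr_gt0; lra.
have rE : r ^+ 2 * (1 + v) = 1.
  by rewrite exprVn sqr_sqrtr ?mulVf//; lra.
have r1 : r <= 1 by nra.
have r2 : 2^-1 <= r by nra.
have wv : 1 - r <= v by nra.
have wE : `|1 - r - v / 2| <= v ^+ 2.
  have [w0 w1] : 0 <= 1 - r /\ 1 - r <= 1 by lra.
  (* This is [r ^+ 2 * (1 + v) = 1] rewritten in terms of [1 - r]; [f1] to [f5] provide the signs of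
     the quadratic and cubic products. *)
  have E : 2 * (1 - r - v / 2)
      = (1 - r) ^+ 2 - 2 * v * (1 - r) + v * (1 - r) ^+ 2.
    by have := rE; rewrite !expr2; lra.
  have f1 : 0 <= (1 - r) * (v - (1 - r)) by rewrite mulr_ge0// subr_ge0.
  have f2 : 0 <= v * (1 - r) * (1 - (1 - r)).
    by rewrite !mulr_ge0// subr_ge0.
  have f3 : 0 <= v * (v - (1 - r)) by rewrite mulr_ge0// subr_ge0.
  have f4 : 0 <= v * (1 - r) ^+ 2 by rewrite mulr_ge0// sqr_ge0.
  have f5 := sqr_ge0 (1 - r).
  rewrite ler_norml; move: E f1 f2 f3 f4 f5; rewrite !expr2 => *.
  by apply/andP; split; lra.
have := @Phi_dilate _ r y; rewrite r2 r1 => /(_ isT) h1.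
have h2 := phi1_bound y.
have B0 := @phi_bound_ge0 R.
rewrite (_ : _ + _ = (Phi (r * y) - Phi y - y * phi y * (r - 1)) +
  (- y * phi y) * (1 - r - v / 2)); last by ring.
apply: (le_trans (ler_normD _ _)); rewrite normrM.
have h3 := ler_pM (normr_ge0 _) (normr_ge0 _) h2 wE.
have h4 : 4 * phi_bound * (r - 1) ^+ 2 <= 4 * phi_bound * v ^+ 2.
  apply: ler_wpM2l; first by rewrite mulr_ge0.
  by rewrite -(sqrrN (r - 1)) opprB lerXn2r ?nnegrE ?subr_ge0.
lra.
Qed.

(* [u tau x = Phi ((t - x) / sqrt tau)] solves the heat equation, so averaging
   over centered increments of second moment [delta] turns [u tau] into
   [u (tau + delta)] up to terms of third order. *)
Lemma avg_Phi_step p a (H e tau t x : R) :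
  (forall i, 0 <= p i) -> \sum_i p i = 1 -> mean p a = 0 ->
  (forall i, `|a i| <= H) -> 0 < e -> e <= tau -> mom2 p a <= e ->
  `|avg p a (fun z => Phi ((t - z) / Num.sqrt tau)) x
     - Phi ((t - x) / Num.sqrt (tau + mom2 p a))|
  <= phi_bound * (H / Num.sqrt e) ^+ 3 + 5 * phi_bound * (mom2 p a / e) ^+ 2.
Proof.
move=> p0 p1 a0 aH e0 et de; set d := mom2 p a.
have d0 : 0 <= d by apply: sumr_ge0 => i _; rewrite mulr_ge0 ?sqr_ge0.
have tau0 : 0 < tau by lra.
set q : R := Num.sqrt tau.
have q0 : 0 < q by rewrite sqrtr_gt0.
have qE : q ^+ 2 = tau by rewrite sqr_sqrtr// ltW.
have B0 := @phi_bound_ge0 R.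
set y := (t - x) / q; set v := d / tau.
have v01 : 0 <= v <= 1.
  by rewrite divr_ge0 ?(ltW tau0)//= ler_pdivrMr// mul1r; exact: le_trans et.
have -> : (t - x) / Num.sqrt (tau + d) = y / Num.sqrt (1 + v).
  have -> : tau + d = tau * (1 + v) by rewrite /v; field; rewrite gt_eqF.
  by rewrite (sqrtrM _ (ltW tau0)) -/q invfM mulrA.
have h1 : `|avg p a (fun z => Phi ((t - z) / q)) x - Phi y + y * phi y * v / 2|
    <= phi_bound * (H / Num.sqrt e) ^+ 3.
  (* After averaging, the first-order terms cancel because the steps are centered, and the
     second-order terms add up to [y * phi y * v / 2]. *)
  pose rem i := Phi (y + (- a i / q)) - Phi y - phi y * (- a i / q)
    + y * phi y * (- a i / q) ^+ 2 / 2.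
  have -> : avg p a (fun z => Phi ((t - z) / q)) x - Phi y + y * phi y * v / 2
      = \sum_i p i * rem i.
    have -> : Phi y = \sum_i p i * Phi y by rewrite -mulr_suml p1 mul1r.
    have -> : y * phi y * v / 2
        = \sum_i (y * phi y * (p i * a i ^+ 2 / tau / 2) + phi y * (p i * a i) / q).
      rewrite big_split/= -mulr_sumr -!mulr_suml -mulr_sumr.
      by rewrite -/(mean p a) a0 mulr0 mul0r addr0 /v /d /mom2; ring.
    rewrite /avg -sumrB -big_split/=; apply: eq_bigr => i _.
    rewrite /rem (_ : (t - (x + a i)) / q = y + (- a i / q)); last first.
      by rewrite /y; field; rewrite gt_eqF.
    by rewrite -qE; field; rewrite gt_eqF.
  apply: (le_trans (ler_norm_sum _ _ _)).
  rewrite -[leRHS]mul1r -p1 mulr_suml; apply: ler_sum => i _.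
  rewrite normrM ger0_norm// ler_wpM2l//.
  apply: (le_trans (Phi_taylor2 _ _)); rewrite ler_wpM2l//.
  have H0 : 0 <= H by exact: le_trans (aH i).
  rewrite lerXn2r ?nnegrE ?divr_ge0// normrM normrN normfV (gtr0_norm q0).
  by rewrite ler_pM ?invr_ge0 ?(ltW q0)// lef_pV2 ?posrE ?sqrtr_gt0// ler_wsqrtr.
have h2 := Phi_rescale y v01.
have h3 : 5 * phi_bound * v ^+ 2 <= 5 * phi_bound * (d / e) ^+ 2.
  apply: ler_wpM2l; first by rewrite mulr_ge0.
  rewrite lerXn2r ?nnegrE ?divr_ge0 ?(ltW tau0) ?(ltW e0)//.
  by rewrite ler_wpM2l// lef_pV2.
(* The heat equation at work: the expansion in space ([h1]) and the one in the variance ([h2]) have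
   the same leading term, which cancels. *)
apply: (le_trans _ (lerD h1 (le_trans h2 h3))).
apply: (le_trans _ (ler_normB _ _)).
by rewrite le_eqVlt; apply/orP; left; apply/eqP; congr `|_|; ring.
Qed.

(** With [q] the root of the sample size, [q ^+ 2] steps with errors of order [q ^- 3] and [q ^- 4]
    leave a total error of order [1 / q]. *)
Let clt_rate (B b V e g q : R) : 0 <= B -> 0 < e -> 0 < g -> 1 <= q ->
  q ^+ 2 * (B * (b / q / g) ^+ 3 + 5 * B * (V / q ^+ 2 / e) ^+ 2)
  <= (B * (b / g) ^+ 3 + 5 * B * (V / e) ^+ 2) / q.
Proof.
move=> B0 e0 g0 q1; have q0 : 0 < q by exact: lt_le_trans q1.
have -> : q ^+ 2 * (B * (b / q / g) ^+ 3 + 5 * B * (V / q ^+ 2 / e) ^+ 2)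
    = B * (b / g) ^+ 3 / q + 5 * B * (V / e) ^+ 2 / q ^+ 2.
  by field; rewrite !gt_eqF.
rewrite [leRHS]mulrDl lerD2l; apply: ler_wpM2l.
  by apply: mulr_ge0; [exact: mulr_ge0 | exact: sqr_ge0].
by rewrite lef_pV2 ?posrE ?exprn_gt0// expr2 ler_peMr// ltW.
Qed.

(** The initial smoothing variance [e > 0] bounds the variance below throughout the flow, so the
    one-step errors are uniform. *)
Lemma iter_avg_Phi_cvg p xi (b V e t : R) :
  (forall i, 0 <= p i) -> \sum_i p i = 1 -> mean p xi = 0 ->
  (forall i, `|xi i| <= b) -> mom2 p xi = V -> 0 < e ->
  iter n (avg p (fun i => xi i / Num.sqrt n%:R))
    (fun z => Phi ((t - z) / Num.sqrt e)) 0 @[n --> \oo]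
  --> Phi (t / Num.sqrt (e + V)).
Proof.
move=> p0 p1 m0 xib xiV e0.
have V0 : 0 <= V by rewrite -xiV; apply: sumr_ge0 => i _; rewrite mulr_ge0 ?sqr_ge0.
pose K := phi_bound * (b / Num.sqrt e) ^+ 3 + 5 * phi_bound * (V / e) ^+ 2.
have bnd : \forall n \near \oo,
  `|iter n (avg p (fun i => xi i / Num.sqrt n%:R))
    (fun z => Phi ((t - z) / Num.sqrt e)) 0 - Phi (t / Num.sqrt (e + V))|
  <= K * (Num.sqrt n%:R)^-1.
  near=> n.
  have n0 : 0 < n%:R :> R by rewrite ltr0n; near: n; exact: nbhs_infty_gt.
  have nV : V / n%:R <= e.
    rewrite ler_pdivrMr// mulrC -ler_pdivrMr//; near: n; exact: nbhs_infty_ger.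
  set q : R := Num.sqrt n%:R.
  have q0 : 0 < q by rewrite sqrtr_gt0.
  have qE : q ^+ 2 = n%:R by rewrite sqr_sqrtr// ltW.
  have q1 : 1 <= q.
    by rewrite -sqrtr1 ler_wsqrtr// (_ : 1 = 1%:R)// ler_nat -(ltr0n R).
  pose a i := xi i / q.
  have am : mean p a = 0.
    rewrite -[RHS](mul0r q^-1) -m0 /mean mulr_suml.
    by apply: eq_bigr => i _; rewrite mulrA.
  have aV : mom2 p a = V / n%:R.
    rewrite -xiV /mom2 mulr_suml; apply: eq_bigr => i _.
    by rewrite /a expr_div_n qE mulrA.
  (* Each step adds variance [V / n], so after [n] steps the flow has reached [e + V]. *)
  pose u j (x : R) := Phi ((t - x) / Num.sqrt (e + j%:R * mom2 p a)).
  have u0 : u 0 = fun z => Phi ((t - z) / Num.sqrt e).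
    by apply/funext => z; rewrite /u mul0r addr0.
  have un : u n 0 = Phi (t / Num.sqrt (e + V)).
    by rewrite /u subr0 aV mulrCA divff ?mulr1 ?gt_eqF.
  rewrite -u0 -un.
  apply: (le_trans (@iter_avg_telescope _ _ p a p0 p1 u n
    (phi_bound * (b / q / Num.sqrt e) ^+ 3
     + 5 * phi_bound * (mom2 p a / e) ^+ 2) _ 0)).
    move=> j x jn; rewrite /u.
    have -> : e + j.+1%:R * mom2 p a = e + j%:R * mom2 p a + mom2 p a.
      by rewrite -natr1; ring.
    apply: (@avg_Phi_step p a (b / q) e _ t x p0 p1 am _ e0).
    - move=> i; rewrite /a normrM normfV (gtr0_norm q0).
      by rewrite ler_wpM2r// invr_ge0 ltW.
    - by rewrite lerDl aV mulr_ge0// divr_ge0// ltW.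
    - by rewrite aV.
  by rewrite aV -qE /K; apply: clt_rate; rewrite ?phi_bound_ge0 ?sqrtr_gt0.
apply/cvgrPdist_le => /= eps eps0.
(* A negative [b] would force the index type to be empty, contradicting total mass 1. *)
have b0 : 0 <= b.
  apply: contrapT => /negP; rewrite -ltNge => b0.
  have : \sum_i p i = 0; last by rewrite p1 => /eqP; rewrite oner_eq0.
  rewrite big1// => i _.
  by have := le_lt_trans (le_trans (normr_ge0 _) (xib i)) b0; rewrite ltxx.
have K0 : 0 <= K.
  have B0 := @phi_bound_ge0 R.
  apply: addr_ge0; apply: mulr_ge0 => //.
  - by rewrite exprn_ge0// divr_ge0// sqrtr_ge0.
  - exact: mulr_ge0.
  - exact: sqr_ge0.
near=> n; rewrite distrC; apply: (le_trans (near bnd n _)) => //.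
have n0 : 0 < n%:R :> R by rewrite ltr0n; near: n; exact: nbhs_infty_gt.
rewrite ler_pdivrMr ?sqrtr_gt0// mulrC -ler_pdivrMr//.
rewrite -[leLHS]ger0_norm ?divr_ge0 ?(ltW eps0)// -sqrtr_sqr ler_wsqrtr//.
near: n; exact: nbhs_infty_ger.
Unshelve. all: by end_near. Qed.

End CLT.

(** * Laws of sums over a sample *)

Section SampleLaw.
Context {R : realType} {d : measure_display} {T : measurableType d}.
Context {P : probability T R}.
Variable X : nat -> {RV P >-> R}.
Hypothesis X_indep : mutually_independent X.
Variable F : R -> R.
Hypothesis X_cdf : forall i x, cdf (X i) x = (F x)%:E.

Lemma sample_prob_itv k (a b : R) : a <= b ->
  P (X k @^-1` `]a, b]) = ((F b)%:E - (F a)%:E)%E.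
Proof.
move=> ab; rewrite -!(X_cdf k) -[LHS]/(distribution P (X k) `]a, b]).
have -> : `]a, b]%classic = `]-oo, b] `\` `]-oo, a] :> set R.
  by rewrite -[RHS]setCK setCD setCitvl setUC -[LHS]setCK setCitv.
rewrite measureD ?setIidr//; first exact: subset_itvl.
by rewrite -ge0_fin_numE// fin_num_measure.
Qed.

(** The cdf fixes the law on half-open intervals, which are closed under intersection, generate the
    Borel sets and exhaust the line. *)
Lemma sample_identically_distributed i j (A : set R) : measurable A ->
  P (X i @^-1` A) = P (X j @^-1` A).
Proof.
apply: (@measure_unique _ R _ (@ocitv R) (fun k => `]- k%:R, k%:R]%classic)
  _ _ _ _ (distribution P (X i)) (distribution P (X j))) => //.
- exact: ocitvI.
- by move=> k; exact: is_ocitv.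
- rewrite -subTset => x _; exists (Num.bound x) => //=.
  by rewrite in_itv/= ltrNl unstable.ltrNbound ltW// unstable.ltr_bound.
- move=> _ [[a b] /= _ <-].
  have [ab|ba] := leP a b; first by rewrite /distribution /pushforward !sample_prob_itv.
  by rewrite set_itv_ge ?measure0// bnd_simp -leNgt ltW.
- by move=> k; rewrite -ge0_fin_numE// fin_num_measure.
Qed.

(** * Sums of finitely valued functions of the observations *)

Section Cells.
Context {I : finType} (kap : R -> I).
Hypothesis mkap : forall i, measurable (kap @^-1` [set i]).

Definition cell_prob i : R := fine (P (X 0 @^-1` (kap @^-1` [set i]))).

Lemma measurable_cell j i : measurable (X j @^-1` (kap @^-1` [set i])).
Proof. by rewrite -[_ @^-1` _]setTI; exact: measurable_funPT. Qed.

Lemma cell_prob_ge0 i : 0 <= cell_prob i.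
Proof. exact: fine_ge0. Qed.

Lemma cell_probE j i : P (X j @^-1` (kap @^-1` [set i])) = (cell_prob i)%:E.
Proof.
rewrite fineK ?fin_num_measure//; last exact: measurable_cell.
exact: sample_identically_distributed.
Qed.

Lemma partition_cells j (A : set T) : measurable A ->
  P A = (\sum_i P (A `&` X j @^-1` (kap @^-1` [set i])))%E.
Proof.
move=> mA; rewrite fsbig_seq ?index_enum_uniq// -measure_fin_bigcup//; last 2 first.
- by move=> i k _ _ [w [[_ /= <-] [_ /= <-]]].
- by move=> i _; apply: measurableI => //; exact: measurable_cell.
congr (P _); apply/seteqP; split=> [w Aw|w [i _ []]//].
by exists (kap (X j w)) => //=; rewrite mem_index_enum.
Qed.

Lemma sum_cell_prob (S : pred I) :
  \sum_i cell_prob i * (S i)%:R = fine (P (X 0 @^-1` (kap @^-1` [set` S]))).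
Proof.
have mA : measurable (kap @^-1` [set` S]).
  have -> : kap @^-1` [set` S] = \bigcup_(i in [set` S]) (kap @^-1` [set i]).
    apply/seteqP; split=> [x Sx|x [i Si /= ->]//].
    by exists (kap x).
  by apply: fin_bigcup_measurable => //; exact: finite_finset.
rewrite [X in fine X](partition_cells 0)//; last first.
  by rewrite -[_ @^-1` _]setTI; exact: measurable_funPT.
rewrite [X in fine X](_ : _ = (\sum_i (cell_prob i * (S i)%:R)%:E)%E).
  by rewrite sumEFin.
apply: eq_bigr => i _; case: (boolP (S i)) => Si.
  rewrite mulr1 -(cell_probE 0); congr (P _).
  by apply/seteqP; split=> [w []//|w /= E]; split => //; rewrite /= E.
rewrite mulr0 (_ : _ `&` _ = set0) ?measure0//.
by rewrite -subset0 => w [/= + E]; rewrite E; apply/negP.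
Qed.

Lemma sum_cell_prob1 : \sum_i cell_prob i = 1.
Proof.
under eq_bigr do rewrite -[cell_prob _]mulr1.
rewrite (sum_cell_prob predT) (_ : _ @^-1` _ = setT) ?probability_setT//.
by apply/seteqP; split.
Qed.

Variable a : I -> R.
Implicit Types (Q : pred R) (m : nat) (x : R).

(** The starting point [x] is kept free because removing the last summand moves it by [a i], just as
    [avg] does. *)
Definition partial_sum m x : T -> R :=
  fun w => x + \sum_(l < m) a (kap (X l w)).

Lemma partial_sumS Q m x : partial_sum m.+1 x @^-1` [set` Q] =
  \bigcup_i (partial_sum m (x + a i) @^-1` [set` Q] `&`
             X m @^-1` (kap @^-1` [set i])).
Proof.
have E w : partial_sum m.+1 x w = partial_sum m (x + a (kap (X m w))) w.
  by rewrite /partial_sum big_ord_recr/= -addrA; congr (_ + _); rewrite addrC.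
apply/seteqP; split => [w /=|w [i _ [/= + i_]]]; rewrite E.
  by exists (kap (X m w)).
by rewrite i_.
Qed.

Lemma measurable_partial_sum_event Q m x :
  measurable (partial_sum m x @^-1` [set` Q]).
Proof.
elim: m x => [|m IH] x.
  rewrite /partial_sum (_ : (fun w => _) = cst x); last first.
    by apply/funext => w; rewrite big_ord0 addr0.
  by rewrite preimage_cst; case: ifP.
rewrite partial_sumS; apply: fin_bigcup_measurable.
  exact: finite_finset.
by move=> i _; apply: measurableI => //; exact: measurable_cell.
Qed.

(* The extra independent event indexed by [J] makes the induction on the number
   of summands go through. *)
Lemma sample_law_joint Q m x (J : {fset nat}) (B : nat -> set R) :
  (forall i, measurable (B i)) -> (forall j, j \in J -> (m <= j)%N) ->
  P (partial_sum m x @^-1` [set` Q]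
     `&` \bigcap_(j in [set` J]) X j @^-1` B j) =
  ((iter m (avg cell_prob a) (fun y => (Q y)%:R) x)%:E
   * P (\bigcap_(j in [set` J]) X j @^-1` B j))%E.
Proof.
move=> + Jm; elim: m x J B Jm => [|m IH] x J B Jm mB.
  rewrite /= /partial_sum (_ : (fun w => _) = cst x); last first.
    by apply/funext => w; rewrite big_ord0 addr0.
  case: (boolP (Q x)) => Qx.
    rewrite (_ : cst x @^-1` _ = setT) ?setTI ?mul1e//.
    by rewrite -subTset => w _.
  rewrite (_ : cst x @^-1` _ = set0) ?set0I ?measure0 ?mul0e//.
  by rewrite -subset0 => w; apply/negP.
set E := \bigcap_(j in _) _.
have mE : measurable E.
  apply: fin_bigcap_measurable; first exact: finite_fset.
  by move=> j _; rewrite -[_ @^-1` _]setTI; exact: measurable_funPT.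
rewrite (partition_cells m); last first.
  by apply: measurableI => //; exact: measurable_partial_sum_event.
(* Fixing the cell of observation [m] adds [m] to the index set with that cell as its event; [m] is
   not in [J], whose indices all exceed it. *)
pose J' := (m |` J)%fset.
pose B' i j := if j == m then kap @^-1` [set i] else B j.
have mB' i j : measurable (B' i j) by rewrite /B'; case: ifP.
have mJ : m \notin J by apply/negP => /Jm; rewrite ltnn.
have EB' i : \bigcap_(j in [set` J]) X j @^-1` B' i j = E.
  apply: eq_bigcapr => j /=; rewrite /B'; case: eqP => // ->.
  by move=> jJ; rewrite jJ in mJ.
have EJ' i : \bigcap_(j in [set` J']) X j @^-1` B' i j
    = X m @^-1` (kap @^-1` [set i]) `&` E.
  by rewrite bigcap_fsetU1 EB' /B' eqxx.
have PE : P E = (\prod_(j <- J) P (X j @^-1` B j))%E by exact: X_indep.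
have PJ' i : P (X m @^-1` (kap @^-1` [set i]) `&` E) = ((cell_prob i)%:E * P E)%E.
  rewrite -EJ' X_indep// big_fsetU1//= {1}/B' eqxx cell_probE PE; congr (_ * _)%E.
  rewrite !big_seq; apply: eq_bigr => j jJ; rewrite /B'; case: eqP => // jm.
  by rewrite -jm jJ in mJ.
transitivity (\sum_i ((cell_prob i
    * iter m (avg cell_prob a) (fun y => (Q y)%:R) (x + a i))%:E * P E))%E.
  apply: eq_bigr => i _; rewrite EFinM -muleA muleCA -PJ' -EJ' -IH//; last first.
    by move=> j; rewrite !inE => /predU1P[->//|/Jm /ltnW].
  rewrite EJ'; congr (P _); rewrite partial_sumS.
  apply/seteqP; split => [w [[[k _ [Qk /= kE]] Ew] /= iE]|w [Qi [iE Ew]]].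
    by split; [move: Qk; rewrite -kE iE|].
  by split; [split; [exists i|]|].
rewrite iterS {1}/avg -sumEFin ge0_sume_distrl// => i _.
rewrite lee_fin mulr_ge0 ?cell_prob_ge0//.
rewrite -[X in X <= _](@iter_avg_cst _ _ cell_prob a sum_cell_prob1 m 0 (x + a i)).
by apply: le_iter_avg => [j|y]; [exact: cell_prob_ge0|exact: ler0n].
Qed.

Lemma sample_law Q m x : P (partial_sum m x @^-1` [set` Q]) =
  (iter m (avg cell_prob a) (fun y => (Q y)%:R) x)%:E.
Proof.
have := @sample_law_joint Q m x fset0 (fun=> setT) (fun=> measurableT).
have -> : \bigcap_(j in [set` fset0]) X j @^-1` setT = setT.
  by rewrite -subTset => w _ j.
by rewrite setIT probability_setT mule1; apply.
Qed.

Lemma sample_sum_law Q m :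
  P [set w | Q (\sum_(l < m) a (kap (X l w)))] =
  (iter m (avg cell_prob a) (fun y => (Q y)%:R) 0)%:E.
Proof.
rewrite -sample_law; congr (P _); apply/seteqP.
by split => w /=; rewrite /partial_sum add0r.
Qed.

Lemma measurable_sample_sum Q m :
  measurable [set w | Q (\sum_(l < m) a (kap (X l w)))].
Proof.
have := measurable_partial_sum_event Q m 0; congr (measurable _).
by apply/seteqP; split => w /=; rewrite /partial_sum add0r.
Qed.

Lemma measurable_fun_sample_sum m :
  measurable_fun setT (fun w => \sum_(l < m) a (kap (X l w))).
Proof.
apply: (measurability (@RGenOInfty.G R)
  (RGenOInfty.measurableE R)) => //.
move=> _ [_ [u ->] <-]; rewrite setTI.
have := measurable_sample_sum (fun y => u < y) m; congr (measurable _).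
by apply/seteqP; split => w /=; rewrite in_itv/= andbT.
Qed.

Lemma sample_chebyshev m (t : R) : 0 < t -> mean cell_prob a = 0 ->
  (P [set w | t <= `|\sum_(l < m) a (kap (X l w))|]%R
   <= (m%:R * mom2 cell_prob a / t ^+ 2)%:E)%E.
Proof.
move=> t0 a0; rewrite (sample_sum_law (fun y => t <= `|y|)) lee_fin.
by apply: iter_avg_chebyshev; [exact: cell_prob_ge0|exact: sum_cell_prob1|..].
Qed.

End Cells.
End SampleLaw.

(** * Joint moments of the indicators of two thresholds *)

Section TwoThresholds.
Context {R : realType} {d : measure_display} {T : measurableType d}.
Context {P : probability T R}.
Variable X : nat -> {RV P >-> R}.
Variable F : R -> R.
Hypothesis X_cdf : forall i x, cdf (X i) x = (F x)%:E.
Variables u v : R.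

Definition below2 (x : R) : bool * bool := (x <= u, x <= v).

Lemma measurable_below2 i : measurable (below2 @^-1` [set i]).
Proof.
have mle (c : R) (b : bool) : measurable [set x : R | (x <= c) = b].
  case: b; first by rewrite -set_itvNyc.
  rewrite (_ : [set x | _] = `]c, +oo[%classic)//; apply/seteqP.
  by split => x /=; rewrite in_itv/= andbT ltNge; case: (x <= c).
case: i => b1 b2; rewrite (_ : _ @^-1` _ =
    [set x : R | (x <= u) = b1] `&` [set x : R | (x <= v) = b2]); last first.
  by apply/seteqP; split => x; rewrite /below2/= => -[-> ->].
exact: measurableI.
Qed.

Local Notation p := (cell_prob X below2).

(** As [u <= v], the product of the two indicators is the first one; hence [c3] joins [c1], and all
    first and second moments are affine in [F u] and [F v]. *)
Lemma below2_sum c0 c1 c2 c3 : u <= v ->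
  \sum_i p i * (c0 + c1 * i.1%:R + c2 * i.2%:R + c3 * (i.1 && i.2)%:R)
  = c0 + (c1 + c3) * F u + c2 * F v.
Proof.
move=> uv.
have cdfE (S : pred (bool * bool)) c :
    (forall x, S (below2 x) = (x <= c)) -> \sum_i p i * (S i)%:R = F c.
  move=> Sc; rewrite (sum_cell_prob X_cdf measurable_below2) -[RHS]/(fine (F c)%:E).
  rewrite -(X_cdf 0); congr (fine (P _)); apply/seteqP.
  by split => w /=; rewrite in_itv/= -Sc.
have E1 := cdfE fst u (fun=> erefl).
have E2 := cdfE snd v (fun=> erefl).
have E3 : \sum_i p i * (i.1 && i.2)%:R = F u.
  apply: (cdfE (fun i => i.1 && i.2)) => x /=.
  by apply/andP/idP => [[]//|xu]; rewrite xu (le_trans xu).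
under eq_bigr => i _.
  rewrite !mulrDr (mulrC _ c0) (mulrCA _ c1) (mulrCA _ c2) (mulrCA _ c3).
  over.
rewrite !big_split/= -!mulr_sumr E1 E2 E3 (sum_cell_prob1 X_cdf measurable_below2).
by ring.
Qed.

Lemma below2_mean c0 c1 c2 : u <= v ->
  mean p (fun i => c0 + c1 * i.1%:R + c2 * i.2%:R) = c0 + c1 * F u + c2 * F v.
Proof.
move=> uv; have := below2_sum c0 c1 c2 0 uv; rewrite addr0 => <-.
by apply: eq_bigr => i _; rewrite mul0r addr0.
Qed.

Lemma below2_mom2 c0 c1 c2 : u <= v ->
  mom2 p (fun i => c0 + c1 * i.1%:R + c2 * i.2%:R) =
  c0 ^+ 2 + (c1 ^+ 2 + 2 * c0 * c1 + 2 * c1 * c2) * F u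
    + (c2 ^+ 2 + 2 * c0 * c2) * F v.
Proof.
move=> uv; rewrite -(below2_sum _ _ _ _ uv).
(* Indicators are idempotent, so the square again has the shape treated in [below2_sum]; the
   identity is checked on the four cells. *)
by apply: eq_bigr => -[[] []] _ /=; congr (_ * _); ring.
Qed.

End TwoThresholds.

(** * Order statistics *)

Section OrderStat.
Context {R : realType}.

(** In the sorted list the entries below [u] form a prefix. The strict inequality on the right
    reflects that [i] counts from 0. *)
Lemma nth_sort_le (s : seq R) (i : nat) (u : R) : (i < size s)%N ->
  (nth 0 (sort <=%R s) i <= u) = (i < count (fun x => (x <= u)%R) s)%N.
Proof.
move=> si; set t := sort <=%R s.
have st : sorted <=%R t by exact: sort_le_sorted.
have -> : count (fun x => (x <= u)%R) s = count (fun x => (x <= u)%R) t.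
  by apply/permP; rewrite perm_sym perm_sort.
have szt : size t = size s by rewrite size_sort.
have nth_homo k l : (k <= l)%N -> (l < size t)%N -> nth 0 t k <= nth 0 t l.
  move=> kl lt; apply: (sorted_leq_nth le_trans le_refl 0 st) => //.
  by rewrite inE (leq_ltn_trans kl).
apply/idP/idP => [tu|].
  rewrite -[t](cat_take_drop i.+1) count_cat.
  apply: leq_trans (leq_addr _ _).
  have : all (fun x => (x <= u)%R) (take i.+1 t).
    apply/(all_nthP 0) => k; rewrite size_take_min ltn_min => /andP[ki kt].
    by rewrite nth_take// (le_trans _ tu)// nth_homo// szt.
  by rewrite all_count => /eqP ->; rewrite size_take_min leq_min ltnSn szt si.
apply: contraTT; rewrite -ltNge -leqNgt => tu.
rewrite -[t](cat_take_drop i) count_cat.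
have -> : count (fun x => (x <= u)%R) (drop i t) = 0%N.
  apply/eqP; rewrite -leqn0 leqNgt -has_count; apply/hasPn => x xd.
  have [k kt <-] := nthP 0 xd.
  rewrite nth_drop -ltNge (lt_le_trans tu)// nth_homo ?leq_addr//.
  by move: kt; rewrite size_drop ltn_subRL.
by rewrite addn0 (leq_trans (count_size _ _))// size_take_min geq_minl.
Qed.

Context {d : measure_display} {T : measurableType d} {P : probability T R}.
Variable X : nat -> {RV P >-> R}.

Lemma order_stat_le n j w (u : R) : (j.-1 < n)%N ->
  (order_stat X n j w <= u) = (j.-1 < \sum_(l < n) (X l w <= u)%R)%N.
Proof.
move=> jn; rewrite /order_stat nth_sort_le ?size_map ?size_iota//.
rewrite count_map -sum1_count big_mkcond /=.
by rewrite -(big_mkord xpredT (fun l => (X l w <= u)%R : nat)) /index_iota subn0.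
Qed.

Lemma order_stat_le_sum n j w (u : R) : (0 < j <= n)%N ->
  (order_stat X n j w <= u) = (j%:R <= \sum_(l < n) (X l w <= u)%R%:R :> R).
Proof.
case: j => // j jn; rewrite order_stat_le// -natr_sum ler_nat.
by [].
Qed.

Lemma measurable_order_stat_le n j (u : R) : (0 < j <= n)%N ->
  measurable [set w | order_stat X n j w <= u].
Proof.
move=> jn.
have := measurable_sample_sum X (measurable_below2 u u)
  (fun i => i.1%:R) (fun y => j%:R <= y) n.
congr (measurable _); apply/seteqP.
by split => w /=; rewrite order_stat_le_sum.
Qed.

Lemma measurable_order_stat n j : measurable_fun setT (order_stat X n j).
Proof.
have [jn|nj] := ltnP j.-1 n; last first.
  rewrite (_ : order_stat X n j = cst 0)//; apply/funext => w.
  by rewrite /order_stat nth_default// size_sort size_map size_iota.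
(* Ranks 0 and 1 read the same entry, so the rank can be taken positive. *)
rewrite -[order_stat X n j]/(order_stat X n j.-1.+1).
apply: (measurability (@RGenOInfty.G R)
  (RGenOInfty.measurableE R)) => //.
move=> _ [_ [u ->] <-]; rewrite setTI.
have -> : order_stat X n j.-1.+1 @^-1` `]u, +oo[%classic
    = ~` [set w | order_stat X n j.-1.+1 w <= u].
  by apply/seteqP; split => w /=; rewrite in_itv/= andbT ltNge => /negP.
by apply: measurableC; exact: measurable_order_stat_le.
Qed.

End OrderStat.

(** * Convergence in probability and in law *)

Section InProbability.
Context {R : realType} {d : measure_display} {T : measurableType d}.
Variable P : probability T R.
Implicit Types (D V W : nat -> T -> R).

Definition vanishes_in_prob D := forall e eta : R, 0 < e -> 0 < eta ->
  \forall k \near \oo, (P [set w | (e <= `|D k w|)%R] <= eta%:E)%E.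

Definition tight W := forall eta : R, 0 < eta -> exists2 M : R, 0 < M &
  \forall k \near \oo, (P [set w | (M <= `|W k w|)%R] <= eta%:E)%E.

Lemma measurable_ge_norm (Y : T -> R) (e : R) : measurable_fun setT Y ->
  measurable [set w | e <= `|Y w|].
Proof.
move=> mY; rewrite -[X in measurable X]setTI; apply: measurable_fun_le => //.
exact: measurableT_comp.
Qed.

Lemma measurable_le_lt (Y Z : T -> R) : measurable_fun setT Y ->
  measurable_fun setT Z ->
  measurable [set w | Y w <= Z w] /\ measurable [set w | Y w < Z w].
Proof.
move=> mY mZ; split.
  by rewrite -[X in measurable X]setTI; exact: measurable_fun_le.
have -> : [set w | Y w < Z w] = ~` [set w | Z w <= Y w].
  by apply/seteqP; split => w /=; rewrite ltNge => /negP.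
apply: measurableC; rewrite -[X in measurable X]setTI.
exact: measurable_fun_le.
Qed.

Lemma prob_le_sum (A B C : set T) (x y : R) :
  measurable A -> measurable B -> measurable C -> A `<=` B `|` C ->
  (P B <= x%:E)%E -> (P C <= y%:E)%E -> (P A <= (x + y)%:E)%E.
Proof.
move=> mA mB mC ABC Bx Cy; apply: (@le_trans _ _ (P (B `|` C))).
  by rewrite le_measure ?inE//; exact: measurableU.
by rewrite (le_trans (measureU2 _ _ _))// EFinD leeD.
Qed.

Lemma vanishesD D1 D2 : (forall k, measurable_fun setT (D1 k)) ->
  (forall k, measurable_fun setT (D2 k)) ->
  vanishes_in_prob D1 -> vanishes_in_prob D2 ->
  vanishes_in_prob (fun k w => D1 k w + D2 k w).
Proof.
move=> m1 m2 v1 v2 e eta e0 eta0.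
have [e2 eta2] : 0 < e / 2 /\ 0 < eta / 2 by split; lra.
near=> k; rewrite [eta]splitr.
apply: (@prob_le_sum _ [set w | e / 2 <= `|D1 k w|] [set w | e / 2 <= `|D2 k w|]).
- by apply: measurable_ge_norm; exact: measurable_funD.
- exact: measurable_ge_norm.
- exact: measurable_ge_norm.
- move=> w /= ew; have [h|h] := leP (e / 2) `|D1 k w|; [by left|right].
  by have := le_trans ew (ler_normD _ _); lra.
- by near: k; exact: v1.
- by near: k; exact: v2.
Unshelve. all: by end_near. Qed.

Lemma vanishesZ c D : vanishes_in_prob D -> vanishes_in_prob (fun k w => c * D k w).
Proof.
move=> v e eta e0 eta0; have [->|c0] := eqVneq c 0.
  near=> k; rewrite (_ : [set w | _] = set0) ?measure0 ?lee_fin ?ltW//.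
  by rewrite -subset0 => w /=; rewrite mul0r normr0 leNgt e0.
have nc : 0 < `|c| by rewrite normr_gt0.
have ec : 0 < e / `|c| by rewrite divr_gt0.
have := v _ _ ec eta0; apply: filterS => k; congr (P _ <= _)%E.
by apply/seteqP; split => w /=; rewrite normrM ler_pdivrMr// mulrC.
Unshelve. all: by end_near. Qed.

(* Ghosh's lemma: it is enough to exclude that [V k] and [W k] are separated by
   a fixed level [t], because [W] being tight only finitely many levels
   matter. *)
Lemma vanishes_of_levels V W : (forall k, measurable_fun setT (V k)) ->
  (forall k, measurable_fun setT (W k)) -> tight W ->
  (forall t e eta : R, 0 < e -> 0 < eta -> \forall k \near \oo,
    (P [set w | (V k w <= t)%R /\ (t + e <= W k w)%R] <= eta%:E)%E) ->
  (forall t e eta : R, 0 < e -> 0 < eta -> \forall k \near \oo,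
    (P [set w | (t < V k w)%R /\ (W k w <= t - e)%R] <= eta%:E)%E) ->
  vanishes_in_prob (fun k w => V k w - W k w).
Proof.
move=> mV mW tW VW WV e0 eta e0_gt0 eta_gt0.
pose e := e0 / 3; have e_gt0 : 0 < e by rewrite /e; lra.
have eta2 : 0 < eta / 2 by lra.
have [M M0 WM] := tW _ eta2.
(* The levels have mesh [e = e0 / 3] and start two meshes below [- M]. If [W k w] lies in cell [i0]
   of the grid from [- M], a gap of [3 * e] is detected at level [i0] when [V k w] is below, and at
   level [i0 + 4] when it is above. *)
pose N := (Num.truncn (2 * M / e) + 4).+1.
pose t i : R := - M - 2 * e + i%:R * e.
pose B k i := [set w | V k w <= t i /\ t i + e <= W k w]
  `|` [set w | t i < V k w /\ W k w <= t i - e].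
have mc (c : R) : measurable_fun [set: T] (fun=> c) by exact: measurable_cst.
have mVW k c1 c2 : measurable [set w | V k w <= c1 /\ c2 <= W k w].
  exact: measurableI (measurable_le_lt (mV k) (mc c1)).1
    (measurable_le_lt (mc c2) (mW k)).1.
have mWV k c1 c2 : measurable [set w | c1 < V k w /\ W k w <= c2].
  exact: measurableI (measurable_le_lt (mc c1) (mV k)).2
    (measurable_le_lt (mW k) (mc c2)).1.
have mB k i : measurable (B k i) by exact: measurableU.
pose del := eta / 2 / N%:R.
have N0 : 0 < N%:R :> R by rewrite ltr0n.
have del0 : 0 < del by rewrite /del divr_gt0.
have PB i : \forall k \near \oo, (P (B k i) <= del%:E)%E.
  have del2 : 0 < del / 2 by lra.
  have := VW (t i) e _ e_gt0 del2; have := WV (t i) e _ e_gt0 del2.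
  apply: filterS2 => k h1 h2; rewrite [del]splitr.
  exact: prob_le_sum h2 h1.
have PBall : \forall k \near \oo, forall i : 'I_N, (P (B k i) <= del%:E)%E.
  by apply: filter_forall => i; exact: PB.
near=> k; rewrite [eta]splitr.
apply: (@prob_le_sum _ [set w | M <= `|W k w|] (\big[setU/set0]_(i < N) B k i)).
- by apply: measurable_ge_norm; exact: measurable_funB.
- exact: measurable_ge_norm.
- by apply: bigsetU_measurable.
- move=> w /= Dw; have [h|WltM] := leP M `|W k w|; [by left|right].
  move: WltM; rewrite ltr_norml => /andP[W1 W2].
  pose q := (W k w + M) / e; pose i0 := Num.truncn q.
  have q0 : 0 <= q by rewrite divr_ge0 ?ltW//; lra.
  have /andP[q1 q2] := truncn_itv q0.
  have i0N : (i0 <= Num.truncn (2 * M / e))%N.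
    by rewrite le_truncn// ler_pM2r ?invr_gt0//; lra.
  have i04 : (i0 + 4 < N)%N by rewrite ltnS leq_add2r.
  have qE : q * e = W k w + M by rewrite /q divfK ?gt_eqF.
  have i1 : i0%:R * e <= W k w + M by rewrite -qE ler_pM2r.
  have i2 : W k w + M < i0%:R * e + e.
    by rewrite -qE -[X in _ + X]mul1r -mulrDl natr1 ltr_pM2r.
  have E3 : e0 = 3 * e by rewrite /e; field.
  rewrite -(bigcup_mkord N (B k)); move: Dw; rewrite E3 ler_normr => /orP[h|h].
    exists (i0 + 4)%N; first exact: i04.
    by right; rewrite /t natrD; split => /=; lra.
  exists i0; first exact: leq_ltn_trans (leq_addr 4 i0) i04.
  by left; rewrite /t; split => /=; lra.
- by near: k.
- apply: (@le_trans _ _ (\sum_(i < N) P (B k i))).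
    by apply: content_subadditive => //; exact: bigsetU_measurable.
  apply: (@le_trans _ _ (\sum_(i < N) del%:E)).
    by apply: lee_sum => i _; move: i; near: k.
  rewrite sumEFin lee_fin sumr_const card_ord -[_ *+ N]mulr_natr /del.
  by rewrite divfK// gt_eqF.
Unshelve. all: by end_near. Qed.

(* The normalized sum is tested against [Phi ((t - y) / h ^+ 2)], a smooth
   version of the indicator of [y <= t]. *)
Lemma cvg_law_of_equivalent (X : nat -> {RV P >-> R}) (F : R -> R)
    (I : finType) (kap : R -> I) (xi : I -> R) (V : R) (n : nat -> nat)
    (Y : nat -> T -> R) (x : R) :
  mutually_independent X -> (forall i t, cdf (X i) t = (F t)%:E) ->
  (forall i, measurable (kap @^-1` [set i])) ->
  mean (cell_prob X kap) xi = 0 -> mom2 (cell_prob X kap) xi = V -> 0 < V ->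
  n k @[k --> \oo] --> \oo ->
  (forall k, measurable_fun setT (Y k)) ->
  vanishes_in_prob (fun k w => Y k w -
    \sum_(l < n k) (xi (kap (X l w)) / Num.sqrt (n k)%:R)) ->
  P [set w | Y k w <= x] @[k --> \oo] --> normal_prob 0 (Num.sqrt V) `]-oo, x].
Proof.
have arith1 (h z t : R) : z <= t + h -> h <= t + 2 * h - z by lra.
have arith2 (h z t : R) : t - h < z -> t - 2 * h - z <= - h by lra.
have arith3 (h y s t : R) : y <= t -> t + h < s -> h <= - (y - s) by lra.
have arith4 (h y s t : R) : s <= t - h -> t < y -> h <= y - s by lra.
have squeeze (pr G gu gl qu ql mu ml e : R) :
    `|G - gu| <= e -> `|G - gl| <= e -> `|qu - gu| <= e -> `|ql - gl| <= e ->
    mu <= qu + e -> ql <= ml + e -> pr <= mu + e -> ml <= pr + e ->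
    `|G - pr| <= 4 * e.
  rewrite !ler_norml => /andP[? ?] /andP[? ?] /andP[? ?] /andP[? ?] ? ? ? ?.
  by apply/andP; split; lra.
move=> X_indep X_cdf mkap m0 mV V0 noo mY YS.
set p := cell_prob X kap in m0 mV *.
have p0 := cell_prob_ge0 X kap : forall i, 0 <= p i.
have p1 := sum_cell_prob1 X_cdf mkap : \sum_i p i = 1.
pose S k w := \sum_(l < n k) (xi (kap (X l w)) / Num.sqrt (n k)%:R).
(* Limit of the smoothed test at level [t + 2 * h]; a negative [h] gives the test from below. *)
pose g h t : R := Phi ((t + 2 * h) / Num.sqrt (h ^+ 4 + V)).
have mS k : measurable_fun setT (S k).
  exact: (measurable_fun_sample_sum X mkap (fun i => xi i / Num.sqrt (n k)%:R)).
have mc (c : R) : measurable_fun [set: T] (fun=> c) by exact: measurable_cst.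
pose b : R := \sum_i `|xi i|.
have xib i : `|xi i| <= b by rewrite /b (bigD1 i)//= lerDl sumr_ge0.
have cltE (h t : R) : 0 < h -> forall rho : R, 0 < rho -> \forall k \near \oo,
    `|iter (n k) (avg p (fun i => xi i / Num.sqrt (n k)%:R))
        (fun z => Phi ((t - z) / h ^+ 2)) 0 - Phi (t / Num.sqrt (h ^+ 4 + V))| <= rho.
  move=> h0 rho rho0.
  have h4 : 0 < h ^+ 4 by rewrite exprn_gt0.
  have sq : Num.sqrt (h ^+ 4) = h ^+ 2.
    have -> : h ^+ 4 = (h ^+ 2) ^+ 2 by rewrite -exprM.
    by rewrite sqrtr_sqr ger0_norm// sqr_ge0.
  have := @iter_avg_Phi_cvg _ _ p xi b V _ t p0 p1 m0 xib mV h4.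
  rewrite sq => cl.
  have := cvg_comp _ _ noo cl => /cvgrPdist_le /(_ _ rho0).
  by apply: filterS => k; rewrite distrC.
(* The smoothing width is [h ^+ 2] while levels move by [h]: at distance [h] the smoothed indicator
   takes the values [Phi] of [h^-1] or of [- h^-1], close to 1 or 0. *)
have tail (rho : R) : 0 < rho -> \forall h \near 0^'+,
    1 - rho <= Phi (h^-1) /\ Phi (- h^-1) <= rho.
  move=> rho0.
  have [M1 [_ HM1]] : \forall y \near +oo, 1 - rho <= Phi y.
    by apply: (cvgr_ge 1 (cvg_normal_cdfy 1)); rewrite ltrBlDr ltrDl.
  have [M2 [_ HM2]] : \forall y \near -oo, Phi y <= rho.
    exact: (cvgr_le 0 (cvg_normal_cdfNy 1)).
  pose M := Num.max 1 (Num.max M1 (- M2)).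
  have M0 : 0 < M by rewrite lt_max ltr01.
  near=> h.
  have h0 : 0 < h by [].
  have Mh : M < h^-1.
    rewrite -ltf_pV2 ?posrE ?invr_gt0// invrK; near: h.
    by apply: nbhs_right_lt; rewrite invr_gt0.
  move: Mh; rewrite !gt_max => /andP[_ /andP[h1 h2]].
  by split; [exact: HM1|apply: HM2; rewrite ltrNl].
have gcont : g h x @[h --> 0] --> g 0 x.
  have cPhi (y : R) : Phi z @[z --> y] --> Phi y.
    apply: differentiable_continuous; apply/derivable1_diffP.
    by have := is_derive_Phi y => -[].
  apply: (cvg_comp _ Phi _ (cPhi _)).
  apply: cvgM.
    apply: cvgD; first exact: cvg_cst.
    by apply: cvgM; [exact: cvg_cst|exact: cvg_id].
  apply: cvgV; first by rewrite gt_eqF// sqrtr_gt0 expr0n add0r.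
  apply: (cvg_comp _ Num.sqrt _ (@sqrt_continuous _ _)).
  apply: cvgD; last exact: cvg_cst.
  exact: exprn_continuous.
have PE A : measurable A -> P A = (fine (P A))%:E.
  by move=> mA; rewrite fineK// fin_num_measure.
have mYx k : measurable [set w | Y k w <= x].
  exact: (measurable_le_lt (mY k) (mc x)).1.
rewrite -normal_cdfE normal_cdf_scale ?sqrtr_gt0//.
rewrite (_ : (fun k => P _) =
    EFin \o (fun k => fine (P [set w | Y k w <= x]))); last first.
  by apply/funext => k; exact: PE.
apply: cvg_EFin; first by near=> k.
apply/cvgrPdist_le => /= eta eta0.
have eta4 : 0 < eta / 4 by lra.
have gnear : \forall h \near 0^'+,
    `|g 0 x - g h x| <= eta / 4 /\ `|g 0 x - g (- h) x| <= eta / 4.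
  have gNcont : g (- h) x @[h --> 0] --> g 0 x.
    apply: (cvg_comp _ (fun h => g h x) _ gcont).
    have : (fun h : R => - h) h @[h --> (0 : R)] --> (- 0 : R).
      by apply: cvgN; exact: cvg_id.
    by rewrite oppr0.
  have /cvgrPdist_le/(_ _ eta4) r1 := cvg_at_right_filter gcont.
  have /cvgrPdist_le/(_ _ eta4) r2 := cvg_at_right_filter gNcont.
  exact: filterI r1 r2.
near (0:R)^'+ => h.
have h0 : 0 < h by [].
have [t1 t2] : 1 - eta / 4 <= Phi (h^-1) /\ Phi (- h^-1) <= eta / 4.
  by near: h; exact: tail.
have gx : g 0 x = Phi (x / Num.sqrt V) by rewrite /g mulr0 addr0 expr0n add0r.
have [gp gm] : `|g 0 x - g h x| <= eta / 4 /\ `|g 0 x - g (- h) x| <= eta / 4.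
  by near: h; exact: gnear.
pose q k t := iter (n k) (avg p (fun i => xi i / Num.sqrt (n k)%:R))
  (fun z => Phi ((t - z) / h ^+ 2)) 0.
pose m k u := iter (n k) (avg p (fun i => xi i / Num.sqrt (n k)%:R))
  (fun z => (z <= u)%R%:R) 0.
have PS k u : P [set w | S k w <= u] = (m k u)%:E.
  exact: (sample_sum_law X_indep X_cdf mkap (fun i => xi i / Num.sqrt (n k)%:R)
    (fun y => y <= u)).
have h2 : 0 < h ^+ 2 by rewrite exprn_gt0.
(* Of the total shift [2 * h], one [h] pays for replacing [Y k] by the sum and the other for the
   smoothing. *)
have mq k : m k (x + h) <= q k (x + 2 * h) + eta / 4.
  rewrite /q /m -[X in _ <= _ + X](@iter_avg_cst _ _ p
    (fun i => xi i / Num.sqrt (n k)%:R) p1 (n k) _ 0) -iter_avgD.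
  apply: le_iter_avg => // z.
  have := @normal_cdf_ge0 R 1 ((x + 2 * h - z) / h ^+ 2); rewrite -/(Phi _).
  case: (leP z (x + h)) => zx; last by move=> ?; rewrite addr_ge0// ltW.
  move=> _; rewrite -lerBlDr (le_trans t1)//; apply: normal_cdf_homo.
  rewrite ler_pdivlMr// expr2 mulrA mulVf ?gt_eqF// mul1r; exact: arith1.
have qm k : q k (x - 2 * h) <= m k (x - h) + eta / 4.
  rewrite /q /m -[X in _ <= _ + X](@iter_avg_cst _ _ p
    (fun i => xi i / Num.sqrt (n k)%:R) p1 (n k) _ 0) -iter_avgD.
  apply: le_iter_avg => // z.
  have := @normal_cdf_le1 R 1 ((x - 2 * h - z) / h ^+ 2); rewrite -/(Phi _).
  case: (leP z (x - h)) => zx; first by move=> ?; rewrite (@le_trans _ _ 1)// lerDl ltW.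
  move=> _; rewrite add0r (le_trans _ t2)//; apply: normal_cdf_homo.
  rewrite ler_pdivrMr// expr2 mulNr mulrA mulVf ?gt_eqF// mul1r; exact: arith2.
near=> k.
have YSk : (P [set w | (h <= `|Y k w - S k w|)%R] <= (eta / 4)%:E)%E.
  by near: k; exact: YS.
have mYS : measurable [set w | h <= `|Y k w - S k w|].
  by apply: measurable_ge_norm; exact: measurable_funB.
have mSx u : measurable [set w | S k w <= u].
  exact: (measurable_le_lt (mS k) (mc u)).1.
have U : fine (P [set w | Y k w <= x]) <= m k (x + h) + eta / 4.
  rewrite -lee_fin -PE//; 
  apply: (@prob_le_sum _ [set w | S k w <= x + h] _ _ _ _ _ mYS _ _ YSk) => //.
    move=> w /= Yx; have [//|SY] := leP (S k w) (x + h); [by left|right].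
    by rewrite ler_normr; apply/orP; right; exact: arith3 Yx SY.
  by rewrite PS.
have L : m k (x - h) <= fine (P [set w | Y k w <= x]) + eta / 4.
  rewrite -lee_fin -PS; 
  apply: (@prob_le_sum _ [set w | Y k w <= x] _ _ _ _ _ mYS _ _ YSk) => //.
    move=> w /= Sx; have [//|SY] := leP (Y k w) x; [by left|right].
    by rewrite ler_normr; apply/orP; left; exact: arith4 Sx SY.
  by rewrite -PE.
have C1 : `|q k (x + 2 * h) - g h x| <= eta / 4 by near: k; exact: cltE.
have C2 : `|q k (x - 2 * h) - g (- h) x| <= eta / 4.
  rewrite /g mulrN (_ : (- h) ^+ 4 = h ^+ 4); last by rewrite exprNn; ring.
  by near: k; exact: cltE.
rewrite -gx (_ : eta = 4 * (eta / 4)); last by rewrite mulrC divfK.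
exact: squeeze gp gm C1 C2 (mq k) (qm k) U L.
Unshelve. all: by end_near. Qed.

End InProbability.

(** * Linearization of sample quantiles *)

Section Linearization.
Context {R : realType} {d : measure_display} {T : measurableType d}.
Context {P : probability T R}.
Variable X : nat -> {RV P >-> R}.
Variable F : R -> R.
Hypothesis X_indep : mutually_independent X.
Hypothesis X_cdf : forall i x, cdf (X i) x = (F x)%:E.

Definition count_le m (u : R) (w : T) : R := \sum_(l < m) (X l w <= u)%R%:R.

Lemma cdf_fun_homo : {homo F : x y / x <= y}.
Proof.
by move=> x y xy; rewrite -lee_fin -!(X_cdf 0); exact: cdf_nondecreasing.
Qed.

Lemma cdf_fun_itv x : 0 <= F x <= 1.
Proof. by rewrite -!lee_fin -(X_cdf 0) cdf_ge0 cdf_le1. Qed.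

Lemma measurable_count_le m u : measurable_fun setT (count_le m u).
Proof.
exact: (measurable_fun_sample_sum X (measurable_below2 u u) (fun i => i.1%:R)).
Qed.

Lemma sum_below2 m (u v c0 c1 c2 : R) w :
  \sum_(l < m) (fun i : bool * bool => c0 + c1 * i.1%:R + c2 * i.2%:R)
    (below2 u v (X l w))
  = m%:R * c0 + c1 * count_le m u w + c2 * count_le m v w.
Proof.
by rewrite !big_split/= sumr_const card_ord -!mulr_sumr mulr_natl.
Qed.

Lemma count_chebyshev m (u e : R) : 0 < e ->
  (P [set w | (e <= `|m%:R * F u - count_le m u w|)%R] <= (m%:R / e ^+ 2)%:E)%E.
Proof.
move=> e0; pose a (i : bool * bool) : R := F u + -1 * i.1%:R + 0 * i.2%:R.
have a0 : mean (cell_prob X (below2 u u)) a = 0.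
  by rewrite (below2_mean X_cdf)//; ring.
have a2 : mom2 (cell_prob X (below2 u u)) a <= 1.
  rewrite (below2_mom2 X_cdf)//; have := cdf_fun_itv u.
  by move: (F u) => p /andP[? ?]; nra.
have := sample_chebyshev X_indep X_cdf (measurable_below2 u u) m e0 a0.
under eq_set do rewrite sum_below2 mulN1r mul0r addr0.
move=> /le_trans; apply; rewrite lee_fin ler_wpM2r ?invr_ge0 ?sqr_ge0//.
by rewrite ler_piMr.
Qed.

Lemma count_increment_chebyshev m (u v e : R) : 0 < e ->
  (P [set w | (e <= `|m%:R * (F v - F u) - (count_le m v w - count_le m u w)|)%R]
   <= (m%:R * `|F v - F u| / e ^+ 2)%:E)%E.
Proof.
move=> e0; wlog uv : u v / u <= v => [H|].
  have [|/ltW vu] := leP u v; first exact: H.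
  under eq_set do rewrite -normrN.
  rewrite distrC; have := H v u vu; congr (P _ <= _)%E.
  by apply: eq_set => w; congr (is_true (e <= `|_|)); ring.
pose a (i : bool * bool) : R := (F v - F u) + 1 * i.1%:R + -1 * i.2%:R.
have a0 : mean (cell_prob X (below2 u v)) a = 0.
  by rewrite (below2_mean X_cdf)//; ring.
have Fuv := cdf_fun_homo uv.
have a2 : mom2 (cell_prob X (below2 u v)) a <= `|F v - F u|.
  rewrite (below2_mom2 X_cdf)// ger0_norm ?subr_ge0//.
  by have := sqr_ge0 (F v - F u); move: (F u) (F v) => p q; rewrite !expr2; lra.
have := sample_chebyshev X_indep X_cdf (measurable_below2 u v) m e0 a0.
under eq_set do rewrite sum_below2 mulN1r mul1r -addrA -opprB (addrC (count_le m u _)).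
move=> h; rewrite (le_trans _ (le_trans h _))//.
  rewrite le_eqVlt; apply/orP; left; apply/eqP; congr (P _).
  by apply: eq_set => w; congr (is_true (e <= `|_|)); ring.
rewrite lee_fin ler_wpM2r ?invr_ge0 ?sqr_ge0//.
by rewrite ler_wpM2l.
Qed.

Variables (z c : R).
Hypothesis c_gt0 : 0 < c.
Hypothesis dF : is_derive z 1 F c.

Lemma derive_near_linear (e : R) : 0 < e ->
  \forall h \near 0, `|F (z + h) - F z - c * h| <= e * `|h|.
Proof.
move=> e0; have dz : derivable F z 1 by have := dF => -[].
have E : 'D_1 F z = c by rewrite derive_val.
have : h^-1 *: ((F \o shift z) (h *: 1) - F z) @[h --> 0^'] --> c by rewrite -E.
move=> /cvgrPdist_le /(_ _ e0); rewrite near_withinE; apply: filterS => h.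
have [-> _|h0 /(_ isT)] := eqVneq h 0.
  by rewrite addr0 mulr0 subr0 subrr normr0 mulr0.
rewrite /= [h%:A]mulr1 (addrC h) /GRing.scale/= => H.
have -> : F (z + h) - F z - c * h = - (c - h^-1 * (F (z + h) - F z)) * h.
  by field.
by rewrite normrM normrN ler_wpM2r.
Qed.

Variables n j : nat -> nat.
Hypothesis noo : n k @[k --> \oo] --> \oo.
Hypothesis jn : \forall k \near \oo, (0 < j k <= n k)%N.
Hypothesis jF : forall k, `|(n k)%:R * F z - (j k)%:R| <= 1.

Let rn k : R := Num.sqrt (n k)%:R.

Lemma rn_ge (A : R) : \forall k \near \oo, A <= rn k /\ 0 < rn k.
Proof.
have : \forall m \near \oo, A <= Num.sqrt m%:R :> R /\ 0 < Num.sqrt m%:R :> R.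
  near=> m.
  have m0 : (0 < m)%N by near: m; exact: nbhs_infty_gt.
  split; last by rewrite sqrtr_gt0 ltr0n.
  rewrite (le_trans (ler_norm _))// -sqrtr_sqr ler_wsqrtr//.
  by near: m; exact: nbhs_infty_ger.
exact: noo.
Unshelve. all: by end_near. Qed.

Lemma threshold_shift (t e : R) : 0 < e -> \forall k \near \oo,
  `|rn k * (F (z + t / rn k) - F z) - c * t| <= e.
Proof.
move=> e0; pose e1 := e / (`|t| + 1).
have t1 : 0 < `|t| + 1 by rewrite ltr_wpDl.
have e1_gt0 : 0 < e1 by rewrite divr_gt0.
have [r /= r0 Hr] := derive_near_linear e1_gt0.
near=> k.
have [rk rk0] : (`|t| + 1) / r <= rn k /\ 0 < rn k by near: k; exact: rn_ge.
have /Hr : ball 0 r (t / rn k).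
  rewrite /ball/= sub0r normrN normrM normfV (gtr0_norm rk0) ltr_pdivrMr//.
  rewrite mulrC -ltr_pdivrMr//; apply: lt_le_trans rk.
  by rewrite ltr_pM2r ?invr_gt0// ltrDl.
move=> H; have -> : rn k * (F (z + t / rn k) - F z) - c * t =
    (F (z + t / rn k) - F z - c * (t / rn k)) * rn k.
  by field; rewrite gt_eqF.
rewrite normrM (gtr0_norm rk0) -ler_pdivlMr// (le_trans H)//.
rewrite normrM normfV (gtr0_norm rk0) mulrA ler_wpM2r ?invr_ge0 ?(ltW rk0)//.
rewrite /e1 mulrAC ler_pdivrMr//; apply: ler_wpM2l; first exact: ltW.
by rewrite lerDl.
Unshelve. all: by end_near. Qed.

Definition scaled_dev k w : R := rn k * (order_stat X (n k) (j k) w - z).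
(** The Bahadur linearization of [scaled_dev]. *)
Definition scaled_count k w : R :=
  ((n k)%:R * F z - count_le (n k) z w) / c / rn k.

Lemma measurable_scaled_dev k : measurable_fun setT (scaled_dev k).
Proof.
apply: measurable_funM => //; apply: measurable_funB => //.
exact: measurable_order_stat.
Qed.

Lemma measurable_scaled_count k : measurable_fun setT (scaled_count k).
Proof.
apply: measurable_funM => //; apply: measurable_funM => //.
apply: measurable_funB => //; exact: measurable_count_le.
Qed.

Lemma rn_sqr k : rn k ^+ 2 = (n k)%:R. Proof. by rewrite sqr_sqrtr. Qed.

Lemma tight_scaled_count : tight P scaled_count.
Proof.
(* Chebyshev's bound is [c ^- 2 / M ^+ 2]; since [M >= 1], it is at most [c ^- 2 / M]. *)
move=> eta eta0; pose M := Num.max 1 (c ^- 2 / eta).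
have M1 : 1 <= M by rewrite le_max lexx.
have M0 : 0 < M by exact: lt_le_trans M1.
exists M => //; near=> k.
have [_ rk0] : 0 <= rn k /\ 0 < rn k by near: k; exact: rn_ge.
have e0 : 0 < M * c * rn k by rewrite !mulr_gt0.
have := count_chebyshev (n k) z e0.
rewrite (_ : [set w | _] = [set w | M <= `|scaled_count k w|]).
  move=> /le_trans; apply; rewrite lee_fin !exprMn rn_sqr.
  have n0 : (n k)%:R != 0 :> R by rewrite -rn_sqr expf_neq0// gt_eqF.
  rewrite (_ : _ / _ = c ^- 2 / M ^+ 2); last by field; rewrite n0 !gt_eqF.
  rewrite ler_pdivrMr ?exprn_gt0// mulrC -ler_pdivrMr//.
  rewrite (@le_trans _ _ M)//; first by rewrite le_max lexx orbT.
  by rewrite expr2 ler_peMr// ltW.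
apply: eq_set => w; rewrite /scaled_count !normrM !normfV (gtr0_norm c_gt0).
by rewrite (gtr0_norm rk0) !ler_pdivlMr// mulrAC.
Unshelve. all: by end_near. Qed.

(** A separation by [e] amounts to [r * e * C] on the scale of counts. The linearization of [F] and
    the rounding of the rank each use up a quarter, so half remains for the centered increment
    [D]. *)
Let separation_arith (r t e C n0 Fu Fz Nu Nz jj D : R) :
  0 < r -> 0 < C -> r ^+ 2 = n0 -> `|r * (Fu - Fz) - C * t| <= e * C / 4 ->
  1 <= r * (e * C / 4) -> `|n0 * Fz - jj| <= 1 ->
  D = n0 * (Fu - Fz) - (Nu - Nz) ->
  (jj <= Nu -> t + e <= (n0 * Fz - Nz) / C / r -> r * (e * C / 2) <= - D) /\
  (Nu < jj -> (n0 * Fz - Nz) / C / r <= t - e -> r * (e * C / 2) <= D).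
Proof.
move=> r0 C0 rE; rewrite !ler_norml => /andP[a1 a2] re /andP[b1 b2] ->.
have n0E : n0 * (Fu - Fz) = r * (r * (Fu - Fz)) by rewrite -rE; ring.
have h1 := ler_wpM2l (ltW r0) a1; have h2 := ler_wpM2l (ltW r0) a2.
split => jN.
  by rewrite !ler_pdivlMr// => W; lra.
by rewrite !ler_pdivrMr// => W; lra.
Qed.

Definition count_gap t k w : R := (n k)%:R * (F (z + t / rn k) - F z)
  - (count_le (n k) (z + t / rn k) w - count_le (n k) z w).

(** The count over an interval of length of order [1 / rn k] has variance at most of order [rn k],
    whereas separation needs a deviation of order [rn k]; Chebyshev's bound is [O(1 / rn k)]. *)
Lemma separation (t e eta : R) : 0 < e -> 0 < eta -> \forall k \near \oo,
  [/\ measurable [set w | rn k * (e * c / 2) <= `|count_gap t k w|],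
      (P [set w | (rn k * (e * c / 2) <= `|count_gap t k w|)%R] <= eta%:E)%E,
      forall w, scaled_dev k w <= t /\ t + e <= scaled_count k w ->
        rn k * (e * c / 2) <= `|count_gap t k w|
    & forall w, t < scaled_dev k w /\ scaled_count k w <= t - e ->
        rn k * (e * c / 2) <= `|count_gap t k w|].
Proof.
move=> e0 eta0.
have ec4 : 0 < e * c / 4 by rewrite divr_gt0// mulr_gt0.
pose K := `|c * t| + e * c / 4.
near=> k.
set D := count_gap t k.
have [rk1 rk0] : (e * c / 4)^-1 <= rn k /\ 0 < rn k by near: k; exact: rn_ge.
have [rk2 _] : 4 * K / (e * c) ^+ 2 / eta <= rn k /\ 0 < rn k by near: k; exact: rn_ge.
have shift : `|rn k * (F (z + t / rn k) - F z) - c * t| <= e * c / 4.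
  by near: k; exact: threshold_shift.
have jnk : (0 < j k <= n k)%N by near: k.
have re : 1 <= rn k * (e * c / 4) by rewrite -ler_pdivrMr// mul1r.
have ths w : (scaled_dev k w <= t) = ((j k)%:R <= count_le (n k) (z + t / rn k) w).
  rewrite -order_stat_le_sum// /scaled_dev mulrC -ler_pdivlMr//.
  by rewrite lerBlDr addrC.
have sep w := separation_arith rk0 c_gt0 (rn_sqr k) shift re (jF k) (erefl (D w)).
have e2 : 0 < rn k * (e * c / 2) by rewrite mulr_gt0// divr_gt0// mulr_gt0.
have mD : measurable_fun setT D.
  apply: measurable_funB => //.
  by apply: measurable_funB; exact: measurable_count_le.
split.
- exact: measurable_ge_norm.
- have := count_increment_chebyshev (n k) z (z + t / rn k) e2.
  move=> /le_trans; apply; rewrite lee_fin.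
  have inc : rn k * `|F (z + t / rn k) - F z| <= K.
    rewrite -[X in X * _](gtr0_norm rk0) -normrM /K.
    have -> : rn k * (F (z + t / rn k) - F z)
        = rn k * (F (z + t / rn k) - F z) - c * t + c * t by rewrite subrK.
    by rewrite (le_trans (ler_normD _ _))// addrC lerD2l.
  rewrite -rn_sqr ler_pdivrMr ?exprn_gt0//.
  move: rk2; rewrite ler_pdivrMr// ler_pdivrMr ?exprn_gt0 ?mulr_gt0// => rk2.
  apply: (@le_trans _ _ (rn k * K)).
    by rewrite expr2 -mulrA ler_wpM2l// ltW.
  rewrite (_ : eta * _ = rn k * (rn k * eta * (e * c) ^+ 2 / 4)); last by field.
  by rewrite ler_wpM2l ?(ltW rk0)// ler_pdivlMr// mulrC.
- move=> w [dt tc]; have [+ _] := sep w; rewrite -ths => /(_ dt tc) h.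
  by rewrite ler_normr h orbT.
- move=> w [dt tc]; have [_] := sep w; rewrite ltNge -ths -ltNge => /(_ dt tc) h.
  by rewrite ler_normr h.
Unshelve. all: by end_near. Qed.

Lemma scaled_dev_vanishes :
  vanishes_in_prob P (fun k w => scaled_dev k w - scaled_count k w).
Proof.
have mc (a : R) : measurable_fun [set: T] (fun=> a) by exact: measurable_cst.
have mV := measurable_scaled_dev; have mW := measurable_scaled_count.
apply: vanishes_of_levels => //; first exact: tight_scaled_count.
  move=> t e eta e0 eta0; have := separation t e0 eta0.
  apply: filterS => k [mD PD h _]; apply: le_trans PD.
  rewrite le_measure ?inE//.
  exact: measurableI (measurable_le_lt (mV k) (mc _)).1
    (measurable_le_lt (mc _) (mW k)).1.
move=> t e eta e0 eta0; have := separation t e0 eta0.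
apply: filterS => k [mD PD _ h]; apply: le_trans PD.
rewrite le_measure ?inE//.
exact: measurableI (measurable_le_lt (mc _) (mV k)).2
  (measurable_le_lt (mW k) (mc _)).1.
Qed.

End Linearization.

(** * Linear combinations of two sample quantiles *)

Section TwoQuantiles.
Context {R : realType} {d : measure_display} {T : measurableType d}.
Context {P : probability T R}.
Variable X : nat -> {RV P >-> R}.
Variable F : R -> R.
Hypothesis X_indep : mutually_independent X.
Hypothesis X_cdf : forall i x, cdf (X i) x = (F x)%:E.
Variables (n i j : nat -> nat).
Hypothesis noo : n k @[k --> \oo] --> \oo.
Hypothesis i_n : \forall k \near \oo, (0 < i k <= n k)%N.
Hypothesis j_n : \forall k \near \oo, (0 < j k <= n k)%N.
Variables (z y c e : R).
Hypotheses (zy : z <= y) (c_gt0 : 0 < c) (e_gt0 : 0 < e).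
Hypotheses (dFz : is_derive z 1 F c) (dFy : is_derive y 1 F e).
Hypothesis iF : forall k, `|(n k)%:R * F z - (i k)%:R| <= 1.
Hypothesis jF : forall k, `|(n k)%:R * F y - (j k)%:R| <= 1.
Variables (al be : R).

Definition lin_order_stat k w : R :=
  al * order_stat X (n k) (i k) w + be * order_stat X (n k) (j k) w.

(** For [z <= y] the indicators of [X <= z] and [X <= y] have covariance [F z * (1 - F y)]. *)
Definition lin_var : R := (al / c) ^+ 2 * (F z * (1 - F z))
  + (be / e) ^+ 2 * (F y * (1 - F y)) + 2 * (al / c) * (be / e) * (F z * (1 - F y)).

Lemma measurable_lin_order_stat k : measurable_fun setT (lin_order_stat k).
Proof.
by apply: measurable_funD; apply: measurable_funM => //;
  exact: measurable_order_stat.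
Qed.

Lemma cvg_law_lin_order_stat (x : R) : 0 < lin_var ->
  P [set w | Num.sqrt (n k)%:R * (lin_order_stat k w - (al * z + be * y)) <= x]
    @[k --> \oo] --> normal_prob 0 (Num.sqrt lin_var) `]-oo, x].
Proof.
move=> V0.
pose xi (b : bool * bool) : R := (al / c * F z + be / e * F y)
  + (- (al / c)) * b.1%:R + (- (be / e)) * b.2%:R.
apply: (@cvg_law_of_equivalent _ _ _ P X F _ (below2 z y) xi lin_var n _ x
  X_indep X_cdf (measurable_below2 z y)) => //.
- by rewrite (below2_mean X_cdf)//; ring.
- by rewrite (below2_mom2 X_cdf)// /lin_var; ring.
- move=> k; apply: measurable_funM => //; apply: measurable_funB => //.
  exact: measurable_lin_order_stat.
have v1 := scaled_dev_vanishes X_indep X_cdf c_gt0 dFz noo i_n iF.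
have v2 := scaled_dev_vanishes X_indep X_cdf e_gt0 dFy noo j_n jF.
have := vanishesD _ _ (vanishesZ al v1) (vanishesZ be v2).
set D := (D in vanishes_in_prob P D).
set D' := (D in _ -> vanishes_in_prob P D).
have -> : D = D'.
  apply/funext => k; apply/funext => w; rewrite /D /D'.
  rewrite -mulr_suml sum_below2 /lin_order_stat /scaled_dev /scaled_count.
  by ring.
apply => k; apply: measurable_funM => //; apply: measurable_funB.
- exact: measurable_scaled_dev.
- exact: measurable_scaled_count.
- exact: measurable_scaled_dev.
- exact: measurable_scaled_count.
Qed.

(** The deviation scaled by the root of [n k] is bounded in probability, being close to the tight
    [scaled_count]; dividing by that root gives consistency. *)
Lemma order_stat_consistent :
  vanishes_in_prob P (fun k w => order_stat X (n k) (i k) w - z).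
Proof.
move=> eps eta eps0 eta0.
have v1 := scaled_dev_vanishes X_indep X_cdf c_gt0 dFz noo i_n iF.
have eta2 : 0 < eta / 2 by lra.
have [M M0 WM] := tight_scaled_count X_indep X_cdf z c_gt0 noo eta2.
near=> k.
have [rk rk0] : (M + 1) / eps <= Num.sqrt (n k)%:R :> R /\ 0 < Num.sqrt (n k)%:R :> R.
  by near: k; exact: (rn_ge noo).
rewrite [eta]splitr.
apply: (@prob_le_sum _ _ _ P _
  [set w | M <= `|scaled_count X F z c n k w|]
  [set w | 1 <= `|scaled_dev X z n i k w - scaled_count X F z c n k w|]).
- apply: measurable_ge_norm; apply: measurable_funB => //.
  exact: measurable_order_stat.
- by apply: measurable_ge_norm; exact: measurable_scaled_count.
- apply: measurable_ge_norm; apply: measurable_funB.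
    exact: measurable_scaled_dev.
  exact: measurable_scaled_count.
- move=> w /= ew; have [h|h] := leP M `|scaled_count X F z c n k w|; [by left|right].
  have h1 : M + 1 <= `|scaled_dev X z n i k w|.
    rewrite /scaled_dev normrM gtr0_norm//.
    move: rk; rewrite ler_pdivrMr// => /le_trans; apply.
    by apply: ler_wpM2l => //; exact: ltW.
  rewrite -(lerD2r `|scaled_count X F z c n k w|).
  have := ler_normD (scaled_dev X z n i k w - scaled_count X F z c n k w)
    (scaled_count X F z c n k w).
  rewrite subrK => h2; apply: (le_trans _ h2); apply: le_trans h1.
  by rewrite addrC lerD2r ltW.
- by near: k.
- by near: k; exact: v1.
Unshelve. all: by end_near. Qed.

End TwoQuantiles.

(** * Convergence of expectations *)

Section MeanConvergence.
Context {R : realType} {d : measure_display} {T : measurableType d}.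
Context {P : probability T R}.

Let to_rv (Y : T -> R) : measurable_fun setT Y ->
  {Z : {RV P >-> R} | Z = Y :> (T -> R)}.
Proof.
move=> mY; have mY' : Y \in mfun by rewrite inE.
by exists (mfun_Sub mY').
Qed.

Lemma markov_abs (Y : T -> R) (r : R) : measurable_fun setT Y -> 0 < r ->
  (r%:E * P [set w | r <= `|Y w|]%R <= \int[P]_w `|Y w|%:E)%E.
Proof.
move=> mY r0; have [Z ZE] := to_rv mY.
have := @markov _ _ _ P Z id r r0 (@measurable_id _ _ setT).
by rewrite ZE unlock; apply.
Qed.

Lemma mean_abs_layer_cake (Y : T -> R) : measurable_fun setT Y ->
  (\int[P]_w `|Y w|%:E
   = \int[lebesgue_measure]_(t in `]0%R, +oo[) P [set w | t < `|Y w|]%R)%E.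
Proof.
move=> mY.
have mA : measurable_fun setT (fun w => `|Y w|) by exact: measurableT_comp.
have [Z ZE] := to_rv mA.
have Z0 w : 0 <= Z w by rewrite ZE.
have := ge0_expectation_ccdf Z0; rewrite unlock ZE => ->.
have ccE t : ccdf Z t = P [set w | t < `|Y w|].
  by rewrite /ccdf /distribution /pushforward ZE; congr (P _);
    apply/seteqP; split => w /=; rewrite in_itv/= andbT.
rewrite -integral_itv_obnd_cbnd; last first.
  by apply: measurable_funTS; exact: ccdf_measurable.
by apply: eq_integral => t _; rewrite ccE.
Qed.

Lemma measurable_tail (Y : T -> R) : measurable_fun setT Y ->
  measurable_fun setT (fun t : R => P [set w | t < `|Y w|]).
Proof.
move=> mY.
have mA : measurable_fun setT (fun w => `|Y w|) by exact: measurableT_comp.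
have [Z ZE] := to_rv mA.
rewrite (_ : (fun t : R => _) = ccdf Z); first exact: ccdf_measurable.
apply/funext => t; rewrite /ccdf /distribution /pushforward ZE; congr (P _).
by apply/seteqP; split => w /=; rewrite in_itv/= andbT.
Qed.

Lemma mean_abs_cvg0 (D : nat -> T -> R) (C t0 : R) (K : nat) :
  (forall k, measurable_fun setT (D k)) -> vanishes_in_prob P D ->
  (forall k t, (K <= k)%N -> t0 <= t ->
    (P [set w | t < `|D k w|]%R <= (C / t ^+ 2)%:E)%E) ->
  (\int[P]_w `|D k w|%:E)%E @[k --> \oo] --> 0%E.
Proof.
move=> mD vD tailD.
pose t1 : R := Num.max 1 t0.
have t1_ge1 : 1 <= t1 by rewrite le_max lexx.
(* The dominating function is [C' / (1 + t ^+ 2)]. Up to [t1] it is at least 1; beyond [t1 >= 1] it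
   dominates [C / t ^+ 2] because [1 + t ^+ 2 <= 2 * t ^+ 2]. *)
pose C' : R := Num.max (1 + t1 ^+ 2) (2 * C).
pose g t : \bar R := (C' * (oneDsqr t)^-1)%:E.
have C'0 : 0 <= C' by rewrite le_max addr_ge0// sqr_ge0.
have mt k (t : R) : measurable [set w | t < `|D k w|].
  have mc : measurable_fun [set: T] (fun=> t) by exact: measurable_cst.
  by apply: (measurable_le_lt mc _).2; exact: measurableT_comp.
have dom k (t : R) : (K <= k)%N -> 0 < t -> (P [set w | t < `|D k w|]%R <= g t)%E.
  move=> Kk tp; rewrite /g.
  have [tt1|t1t] := leP t t1.
    apply: (@le_trans _ _ 1%E); first exact: probability_le1 (mt k t).
    rewrite lee_fin ler_pdivlMr// ?mul1r.
    by rewrite le_max /oneDsqr lerD2l lerXn2r ?nnegrE ?(ltW tp)// (le_trans _ t1_ge1).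
  have t0t : t0 <= t by rewrite (le_trans _ (ltW t1t))// le_max lexx orbT.
  apply: (le_trans (tailD _ _ Kk t0t)); rewrite lee_fin.
  have d0 : 0 < oneDsqr t by rewrite (lt_le_trans _ (oneDsqr_ge1 t)).
  rewrite ler_pdivrMr ?exprn_gt0// mulrAC ler_pdivlMr//.
  have [C0|C0] := leP C 0.
    apply: (@le_trans _ _ 0); last by rewrite mulr_ge0// sqr_ge0.
    by rewrite mulr_le0_ge0// ltW.
  apply: (@le_trans _ _ (2 * C * t ^+ 2)).
    rewrite (mulrC 2) -mulrA ler_wpM2l ?(ltW C0)// /oneDsqr.
    have : 1 <= t by rewrite (le_trans t1_ge1)// ltW.
    by move=> t1'; rewrite expr2; nra.
  by rewrite ler_wpM2r ?sqr_ge0// le_max lexx orbT.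
rewrite -(cvg_shiftn K).
have E k : (\int[P]_w `|D k w|%:E = \int[lebesgue_measure]_(t in `]0%R, +oo[)
    P [set w | t < `|D k w|]%R)%E by exact: mean_abs_layer_cake.
under eq_fun do rewrite E.
have <- : (\int[lebesgue_measure]_(t in `]0%R, +oo[) (cst 0 t) = 0 :> \bar R)%E.
  exact: integral0.
pose I : set R := `]0%R, +oo[%classic.
have mf k : measurable_fun I (fun t : R => P [set w | t < `|D (k + K)%N w|]).
  by apply: measurable_funTS; exact: measurable_tail.
have ig : lebesgue_measure.-integrable I g.
  apply: (@integrableS _ _ _ lebesgue_measure `[0%R, +oo[) => //.
  - exact: measurable_itv.
  - by apply: subset_itvr; rewrite bnd_simp.
  have -> : g = (fun t => C'%:E * ((oneDsqr t)^-1)%:E)%E.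
    by apply/funext => t; rewrite -EFinM.
  apply: integrableZl; first exact: measurable_itv.
  apply/integrableP; split.
    apply/measurable_EFinP; apply: measurable_funTS.
    by apply: continuous_measurable_fun; exact: continuous_oneDsqrV.
  rewrite (_ : (fun x => _) = (fun x : R => ((oneDsqr x)^-1)%:E)); last first.
    by apply/funext => x /=; rewrite ger0_norm// invr_ge0 (le_trans _ (oneDsqr_ge1 x)).
  by rewrite integral0y_oneDsqr ltry.
have [] := @dominated_convergence _ _ R lebesgue_measure I _
  (fun k t => P [set w | t < `|D (k + K)%N w|]) (cst 0%E) g mf _ _ ig _ => //.
- exact: measurable_itv.
- apply: aeW => t; rewrite /I /= in_itv/= andbT => tp.
  apply/fine_cvgP; split.
    by near=> k; rewrite fin_num_measure.
  apply/cvgrPdist_le => /= eta eta0.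
  have v := vD _ _ tp eta0.
  have v' : \forall k \near \oo, (P [set w | (t <= `|D (k + K)%N w|)%R] <= eta%:E)%E.
    have := cvg_addnr K; move=> /(_ _ v); exact.
  near=> k.
  rewrite sub0r normrN ger0_norm ?fine_ge0// -lee_fin fineK; last first.
    by rewrite fin_num_measure.
  apply: (@le_trans _ _ (P [set w | (t <= `|D (k + K)%N w|)%R])); last by near: k.
  rewrite le_measure ?inE//.
  - exact: measurable_ge_norm.
  - by move=> w /= /ltW.
apply: aeW => t k; rewrite /I /= in_itv/= andbT => tp.
by rewrite gee0_abs// dom// leq_addl.
Unshelve. all: by end_near. Qed.

Lemma expectation_cvg (Y : nat -> T -> R) (l : R) :
  (forall k, measurable_fun setT (Y k)) ->
  (\forall k \near \oo, P.-integrable setT (EFin \o Y k)) ->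
  (\int[P]_w `|Y k w - l|%:E)%E @[k --> \oo] --> 0%E ->
  'E_P[Y k]%E @[k --> \oo] --> l%:E.
Proof.
move=> mY iY Yl.
apply/fine_cvgP; split.
  near=> k; rewrite unlock; apply: integrable_fin_num => //.
  by near: k.
apply/cvgrPdist_le => /= eta eta0.
near=> k.
have ik : P.-integrable setT (EFin \o Y k) by near: k.
have ic : P.-integrable setT (EFin \o cst l) by exact: finite_measure_integrable_cst.
have -> : l - fine 'E_P[Y k] = - fine (\int[P]_w ((Y k w)%:E - l%:E)%E).
  rewrite (integralB_EFin measurableT ik ic) unlock.
  rewrite [X in (_ - X)%E](_ : _ = l%:E); last first.
    by have := expectation_cst P l; rewrite unlock.
  have := integrable_fin_num measurableT ik; move: (\int[P]_x _)%E => v fv.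
  by rewrite fineB//= opprB.
rewrite normrN -lee_fin.
have fin : (\int[P]_w ((Y k w)%:E - l%:E))%E \is a fin_num.
  apply: integrable_fin_num => //.
  by have := integrableB measurableT ik ic.
have absE (v : \bar R) : v \is a fin_num -> ((`|fine v|%R)%:E = `|v|)%E by case: v.
rewrite absE//.
have le : (`|\int[P]_w ((Y k w)%:E - l%:E)| <= \int[P]_w `|Y k w - l|%:E)%E.
  apply: le_abse_integral => //.
  by apply/measurable_EFinP; apply: measurable_funB.
apply: (le_trans le); near: k.
move/fine_cvgP : Yl => [fy /cvgrPdist_le /(_ _ eta0)]; move: fy; apply: filterS2.
move=> k fk; rewrite sub0r normrN => h.
by rewrite -(fineK fk) lee_fin (le_trans (ler_norm _)).
Unshelve. all: by end_near. Qed.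

End MeanConvergence.

(** * Uniform tail bounds for the order statistics *)

Section Tails.
Context {R : realType} {d : measure_display} {T : measurableType d}.
Context {P : probability T R}.
Variable X : nat -> {RV P >-> R}.
Variable F : R -> R.
Hypothesis X_indep : mutually_independent X.
Hypothesis X_cdf : forall i x, cdf (X i) x = (F x)%:E.

(* Exponential Markov inequality with exponent [- ln H]. *)
Lemma count_chernoff (I : finType) (kap : R -> I) (S : pred I) (m k : nat) (H : R) :
  (forall i, measurable (kap @^-1` [set i])) ->
  \sum_i cell_prob X kap i * (S i)%:R <= H -> 0 < H <= 1 ->
  (P [set w | k%:R <= \sum_(l < m) (S (kap (X l w)))%:R :> R]%R
   <= (2 ^+ m * H ^+ k)%:E)%E.
Proof.
move=> mkap SH /andP[H0 H1].
have p0 := cell_prob_ge0 X kap : forall i, 0 <= cell_prob X kap i.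
have p1 := sum_cell_prob1 X_cdf mkap : \sum_i cell_prob X kap i = 1.
rewrite (sample_sum_law X_indep X_cdf mkap (fun i => (S i)%:R) (fun y => k%:R <= y)).
rewrite lee_fin; pose l := - ln H.
have l0 : 0 <= l by rewrite oppr_ge0 ln_le0.
have El : expR l = H^-1 by rewrite /l expRN lnK.
apply: (@le_trans _ _ (iter m (avg (cell_prob X kap) (fun i => (S i)%:R))
    (fun y => H ^+ k * expR (l * y)) 0)).
  apply: le_iter_avg => // y; case: (leP k%:R y) => [ky|_]; last first.
    by rewrite mulr_ge0 ?exprn_ge0 ?expR_ge0 ?ltW.
  have E1 : H ^+ k * expR (l * k%:R) = 1.
    by rewrite expRM_natr El exprVn divff// expf_neq0// gt_eqF.
  rewrite -[leLHS]/(1 : R) -E1; apply: ler_wpM2l; first by rewrite exprn_ge0// ltW.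
  by rewrite ler_expR ler_wpM2l.
rewrite iter_avgZ iter_avg_exp mulr0 expR0 mul1r mulrC ler_wpM2r ?exprn_ge0 ?(ltW H0)//.
rewrite lerXn2r ?nnegrE//; first by apply: sumr_ge0 => i _; rewrite mulr_ge0 ?expR_ge0.
(* The moment generating function of one indicator is 1 plus [H^-1 - 1] times a probability at most
   [H], hence at most 2. *)
rewrite (eq_bigr (fun i => cell_prob X kap i
    + (H^-1 - 1) * (cell_prob X kap i * (S i)%:R))); last first.
  move=> i _; case: (S i) => /=; rewrite ?mulr1 ?mulr0 ?expR0 ?El; ring.
rewrite big_split/= p1 -mulr_sumr -[leRHS]/(1 + 1) lerD2l.
apply: (@le_trans _ _ ((H^-1 - 1) * H)).
  by rewrite ler_wpM2l// subr_ge0 invf_ge1.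
by rewrite mulrBl mulVf ?gt_eqF// mul1r gerBl ltW.
Qed.

Lemma below2_fst_prob u : \sum_i cell_prob X (below2 u u) i * i.1%:R = F u.
Proof.
have := @below2_mean _ _ _ _ X F X_cdf u u 0 1 0 (lexx _).
rewrite add0r mul1r mul0r addr0 => <-.
by apply: eq_bigr => i _; rewrite add0r mul1r mul0r addr0.
Qed.

Lemma order_stat_lower_tail n j k (u H : R) : (0 < j <= n)%N -> (k <= j)%N ->
  F u <= H -> 0 < H <= 1 ->
  (P [set w | order_stat X n j w <= u]%R <= (2 ^+ n * H ^+ k)%:E)%E.
Proof.
move=> jn kj FH H01.
have := @count_chernoff _ (below2 u u) fst n k H (measurable_below2 u u).
rewrite below2_fst_prob => /(_ FH H01); apply: le_trans.
rewrite le_measure ?inE//.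
- exact: measurable_order_stat_le.
- exact: (measurable_sample_sum X (measurable_below2 u u) (fun i => i.1%:R)
    (fun y => k%:R <= y)).
- move=> w /=; rewrite order_stat_le_sum// => /(le_trans _); apply.
  by rewrite ler_nat.
Qed.

(** If rank [j] lies beyond [u], at most [j - 1] observations are below, so at least
    [n + 1 - j >= k] are above. *)
Lemma order_stat_upper_tail n j k (u H : R) : (0 < j <= n)%N -> (k + j <= n.+1)%N ->
  1 - F u <= H -> 0 < H <= 1 ->
  (P [set w | u < order_stat X n j w]%R <= (2 ^+ n * H ^+ k)%:E)%E.
Proof.
move=> jn kj FH H01.
have := @count_chernoff _ (below2 u u) (fun i => ~~ i.1) n k H (measurable_below2 u u).
have -> : \sum_i cell_prob X (below2 u u) i * (~~ i.1)%:R = 1 - F u.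
  rewrite -below2_fst_prob -[X in X - _](sum_cell_prob1 X_cdf (measurable_below2 u u)).
  rewrite -sumrB.
  by apply: eq_bigr => i _; case: (i.1); rewrite /= ?mulr1 ?mulr0 ?subrr ?subr0.
move=> /(_ FH H01); apply: le_trans.
have mle := measurable_order_stat_le X u jn.
rewrite le_measure ?inE//.
- have -> : [set w | u < order_stat X n j w] = ~` [set w | order_stat X n j w <= u].
    by apply/seteqP; split => w /=; rewrite ltNge => /negP.
  exact: measurableC.
- exact: (measurable_sample_sum X (measurable_below2 u u) (fun i => (~~ i.1)%:R)
    (fun y => k%:R <= y)).
- have jn' : (j.-1 < n)%N by lia.
  move=> w /=; rewrite ltNge order_stat_le// -leqNgt => h.
  rewrite -natr_sum ler_nat.
  have : (\sum_(l < n) (X l w <= u)%R + \sum_(l < n) (~~ (X l w <= u)%R) = n)%N.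
    rewrite -big_split/= (eq_bigr (fun=> 1%N)) ?sum1_card ?card_ord//.
    by move=> l _; case: (X l w <= u).
  move: h; move: (\sum_(l < n) (X l w <= u)%R)%N (\sum_(l < n) ~~ (X l w <= u)%R)%N.
  by clear -jn kj => a b; lia.
Qed.

Lemma cdf_fun_tail_small (e : R) : 0 < e ->
  exists2 M : R, 0 < M & forall t, M <= t -> 1 - F t <= e /\ F (- t) <= e.
Proof.
move=> e0.
have EF : F = fine \o cdf (X 0) by apply/funext => x /=; rewrite X_cdf.
have c1 : F x @[x --> +oo] --> (1 : R) by rewrite EF; exact/fine_cvg/cvg_cdfy1.
have c0 : F x @[x --> -oo] --> (0 : R) by rewrite EF; exact/fine_cvg/cvg_cdfNy0.
have [M1 [_ HM1]] : \forall y \near +oo, 1 - e <= F y.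
  by apply: (cvgr_ge 1 c1); rewrite ltrBlDr ltrDl.
have [M2 [_ HM2]] : \forall y \near -oo, F y <= e by exact: (cvgr_le 0 c0).
pose M := Num.max 0 (Num.max M1 (- M2)).
exists (M + 1); first by rewrite ltr_wpDl// le_max lexx.
move=> t Mt.
have : M < t by rewrite (lt_le_trans _ Mt)// ltrDl.
rewrite !gt_max => /andP[_ /andP[h1 h2]]; split.
  by rewrite lerBlDr addrC -lerBlDr; exact: HM1.
by apply: HM2; rewrite ltrNl.
Qed.

Definition sample_event m (b : nat -> bool) (A B : set R) : set T :=
  \bigcap_(l in [set` [fset x in iota 0 m]%fset]) X l @^-1` (if b l then A else B).

Lemma sample_eventP m b A B w : sample_event m b A B w ->
  forall l, (l < m)%N -> if b l then A (X l w) else B (X l w).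
Proof.
move=> E l lm; have := E l; rewrite /= !inE/= mem_iota/= => /(_ lm).
by case: (b l).
Qed.

(** Each factor of the product is at least the product of both probabilities, so the lower bound
    does not depend on the pattern [b]. *)
Lemma sample_event_prob m b (A B : set R) : measurable A -> measurable B ->
  measurable (sample_event m b A B) /\
  (((fine (P (X 0 @^-1` A)) * fine (P (X 0 @^-1` B))) ^+ m)%:E
   <= P (sample_event m b A B))%E.
Proof.
move=> mA mB; set g := fine _; set h := fine _.
have mAB l : measurable (if b l then A else B) by case: (b l).
have mX l (C : set R) : measurable C -> measurable (X l @^-1` C).
  by move=> mC; rewrite -[_ @^-1` _]setTI; exact: measurable_funPT.
split.
  apply: fin_bigcap_measurable; first exact: finite_fset.
  by move=> l _; exact: mX.
rewrite X_indep//.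
have gE : P (X 0 @^-1` A) = g%:E by rewrite fineK// fin_num_measure//; exact: mX.
have hE : P (X 0 @^-1` B) = h%:E by rewrite fineK// fin_num_measure//; exact: mX.
have g01 : 0 <= g <= 1.
  by rewrite fine_ge0//= -lee_fin -gE probability_le1//; exact: mX.
have h01 : 0 <= h <= 1.
  by rewrite fine_ge0//= -lee_fin -hE probability_le1//; exact: mX.
rewrite (eq_bigr (fun l => (if b l then g else h)%:E)); last first.
  move=> l _; rewrite (sample_identically_distributed X_cdf l 0 (mAB l)).
  by case: (b l).
rewrite prodEFin lee_fin (perm_big (iota 0 m)); last first.
  apply: uniq_perm; rewrite ?fset_uniq ?iota_uniq// => l.
  by rewrite !inE.
have -> : (g * h) ^+ m = \prod_(l <- iota 0 m) (g * h).
  by rewrite big_const_seq count_predT size_iota iter_mulr_1.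
apply: ler_prod => l _.
by move: g01 h01 => /andP[? ?] /andP[? ?]; case: (b l); rewrite mulr_ge0//=; nra.
Qed.

Variables (s : nat) (al be : R).
Hypothesis s_gt0 : (0 < s)%N.
Let n k := (s.+1 * k - 1)%N.
Let L k := lin_order_stat X n id (fun k => s * k)%N al be k.

Lemma sum_ltn (m h : nat) : (h <= m)%N -> (\sum_(l < m) (l < h) = h)%N.
Proof.
move=> hm; rewrite -[RHS](card_ord h) -sum1_card (big_ord_widen m (fun=> 1%N) hm).
by rewrite [RHS]big_mkcond; apply: eq_bigr => l _; case: ltnP.
Qed.

Lemma lin_lower (a1 a2 x1 x2 t M : R) : `|x1| <= M -> t <= `|x2| ->
  `|a2| * t - `|a1| * M <= `|a1 * x1 + a2 * x2|.
Proof.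
move=> x1M tx2; have := ler_normB (a1 * x1 + a2 * x2) (a1 * x1).
rewrite addrAC subrr add0r !normrM => h.
have h1 : `|a1| * `|x1| <= `|a1| * M by exact: ler_wpM2l.
have h2 : `|a2| * t <= `|a2| * `|x2| by exact: ler_wpM2l.
by rewrite lerBlDr (le_trans h2)// (le_trans h)// lerD2l.
Qed.

(** Exactly [k] observations stay bounded, so rank [k] is the last bounded one, and rank [s * k > k]
    is beyond [t]. *)
Lemma lin_order_stat_right k w (M t : R) : (1 < s)%N -> (0 < k)%N -> 0 <= M -> M <= t ->
  (forall l, (l < n k)%N -> if (l < k)%N then - M < X l w <= M else t < X l w) ->
  `|be| * t - `|al| * M <= `|L k w|.
Proof.
move=> s1 k0 M0 Mt Xw.
have kn : (k.-1 < n k)%N by rewrite /n; nia.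
have skn : ((s * k).-1 < n k)%N by rewrite /n; nia.
have kln : (k <= n k)%N by rewrite /n; nia.
apply: lin_lower.
  rewrite ler_norml; apply/andP; split.
    apply: ltW; rewrite ltNge order_stat_le// -leqNgt big1// => l _.
    have := Xw l (ltn_ord l); case: ifP => _ h; apply/eqP; rewrite eqb0 -ltNge.
      by case/andP: h.
    by rewrite (le_lt_trans _ h)// (le_trans _ Mt)// (le_trans _ M0)// oppr_le0.
  rewrite order_stat_le// (@leq_trans k)//; first by rewrite prednK.
  rewrite -[leqLHS](sum_ltn kln); apply: leq_sum => l _.
  by have := Xw l (ltn_ord l); case: ifP => // _ /andP[_ ->].
rewrite (le_trans _ (ler_norm _))// ltW// ltNge order_stat_le// -leqNgt.
apply: (@leq_trans k); last by nia.
rewrite -[leqRHS](sum_ltn kln); apply: leq_sum => l _.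
have := Xw l (ltn_ord l); case: ifP => _ h; first by case: (_ <= _).
by rewrite leNgt h.
Qed.

(** Sending [s * k - 1] observations to the left makes rank [s * k] the first bounded one; rank [k]
    is among the far ones since [k <= s * k - 1]. *)
Lemma lin_order_stat_left k w (M t : R) : (1 < s)%N -> (0 < k)%N -> 0 <= M -> M <= t ->
  (forall l, (l < n k)%N ->
     if ~~ (l < (s * k).-1)%N then - M < X l w <= M else X l w <= - t) ->
  `|al| * t - `|be| * M <= `|L k w|.
Proof.
move=> s1 k0 M0 Mt Xw.
have kn : (k.-1 < n k)%N by rewrite /n; nia.
have skn : ((s * k).-1 < n k)%N by rewrite /n; nia.
have skln : ((s * k).-1 <= n k)%N by exact: ltnW.
have tM : - t <= M by rewrite (@le_trans _ _ 0)// oppr_le0 (le_trans M0).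
rewrite /L /lin_order_stat (addrC (al * _)); apply: lin_lower; last first.
  rewrite ler_normr; apply/orP; right; rewrite lerNr order_stat_le//.
  apply: (@leq_trans (s * k).-1); first by nia.
  rewrite -[leqLHS](sum_ltn skln); apply: leq_sum => l _.
  by have := Xw l (ltn_ord l); case: ifPn => [/negPf ->//|/negPn -> ->].
rewrite ler_norml; apply/andP; split.
  apply: ltW; rewrite ltNge order_stat_le// -leqNgt.
  rewrite -[leqRHS](sum_ltn skln); apply: leq_sum => l _.
  have := Xw l (ltn_ord l).
  case: ifPn => [_ /andP[h _]|/negPn -> _]; last by case: (_ <= _).
  by rewrite leNgt h.
rewrite order_stat_le// (@leq_trans (n k))//.
rewrite -[leqLHS]card_ord -sum1_card; apply: leq_sum => l _.
have := Xw l (ltn_ord l); case: ifPn => [_ /andP[_ ->]//|_ h].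
by rewrite (le_trans h).
Qed.

Lemma lin_order_stat_median k w (t : R) : s = 1%N -> (0 < k)%N ->
  (forall l, (l < n k)%N -> t < X l w) \/ (forall l, (l < n k)%N -> X l w <= - t) ->
  `|al + be| * t <= `|L k w|.
Proof.
move=> s1 k0 Xw; rewrite /L /lin_order_stat s1 mul1n -mulrDl normrM ler_wpM2l//.
have kn : (k.-1 < n k)%N by rewrite /n s1; nia.
rewrite ler_normr; case: Xw => Xw; apply/orP; [left|right].
  rewrite ltW// ltNge order_stat_le// -leqNgt big1// => l _.
  by apply/eqP; rewrite eqb0 -ltNge Xw.
rewrite lerNr order_stat_le// (@leq_trans (n k))//.
rewrite -[leqLHS]card_ord -sum1_card; apply: leq_sum => l _.
by rewrite Xw.
Qed.

Hypotheses (al_neq0 : al != 0) (be_neq0 : be != 0) (albe_neq0 : al + be != 0).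

Lemma sample_prob_ray (t : R) :
  fine (P (X 0 @^-1` `]t, +oo[)) = 1 - F t /\ fine (P (X 0 @^-1` `]-oo, t])) = F t.
Proof.
split; last by rewrite -[P _]/(cdf (X 0) t) X_cdf.
by rewrite -[P _]/(ccdf (X 0) t) ccdf_1_cdf X_cdf.
Qed.

Lemma measurable_L k : measurable_fun setT (L k).
Proof. exact: measurable_lin_order_stat. Qed.

Lemma markov_event k (E : set T) (r v : R) :
  P.-integrable setT (EFin \o L k) -> measurable E -> 0 < r ->
  (v%:E <= P E)%E -> E `<=` [set w | r <= `|L k w|] ->
  v <= fine (\int[P]_w `|L k w|%:E)%E / r.
Proof.
move=> iL mE r0 vE EL.
have mL := measurable_L k.
have fin : (\int[P]_w `|L k w|%:E)%E \is a fin_num.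
  by apply: integrable_fin_num => //; exact: (integrable_norm iL).
rewrite ler_pdivlMr// mulrC -lee_fin EFinM fineK//.
apply: le_trans (markov_abs mL r0); rewrite lee_pmul2l//.
apply: (le_trans vE); rewrite le_measure ?inE//.
exact: measurable_ge_norm.
Qed.

(* If some of the observations stay in a fixed interval while the others exceed
   [t] in absolute value, then only one of the two order statistics is bounded
   and [L k] is of order [t]; Markov's inequality bounds the probability of that
   event. For [s = 1] both order statistics are the median, and all observations
   are taken beyond [t]. *)
Lemma integrable_tail_decay k : (0 < k)%N -> P.-integrable setT (EFin \o L k) ->
  exists g C M : R, [/\ 0 < g, 0 < M & forall t, M <= t ->
    (g * (1 - F t)) ^+ n k <= C / t /\ (g * F (- t)) ^+ n k <= C / t].
Proof.
move=> k0 iL.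
(* Two tails of mass at most 1/4 leave at least 1/2 for [A], so [g] is positive. *)
have q0 : 0 < 4^-1 :> R by rewrite invr_gt0.
have [M M0 HM] := cdf_fun_tail_small q0.
pose A : set R := `]- M, M]%classic.
have mA : measurable A by exact: measurable_itv.
pose g := fine (P (X 0 @^-1` A)).
have g0 : 0 < g.
  have MM : - M <= M by lra.
  have := sample_prob_itv X_cdf 0 MM; rewrite /g => ->.
  by have [h1 h2] := HM _ (lexx M); rewrite /= subr_gt0; lra.
pose ga : R := if (1 < s)%N then Num.min `|al| `|be| else `|al + be|.
have ga0 : 0 < ga.
  by rewrite /ga; case: ifP => _; rewrite ?lt_min ?normr_gt0// al_neq0 be_neq0.
pose K : R := (`|al| + `|be|) * M.
pose e := fine (\int[P]_w `|L k w|%:E)%E.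
(* For [t >= 2 * K / ga] the bounded order statistic costs at most half of [ga * t]; Markov's
   inequality at [ga * t / 2] gives the constant. *)
exists g, (2 * e / ga), (Num.max M (2 * K / ga)); split => //.
  by rewrite lt_max M0.
move=> t; rewrite ge_max => /andP[Mt Kt].
have t0 : 0 < t by exact: lt_le_trans Mt.
have K2 : 2 * K <= ga * t by rewrite (mulrC ga) -ler_pdivrMr.
have r0 : 0 < ga * t / 2 by rewrite divr_gt0// mulr_gt0.
have r_le (x : R) : ga * t - K <= x -> ga * t / 2 <= x by move=> ?; lra.
have CE : e / (ga * t / 2) = 2 * e / ga / t by field; rewrite !gt_eqF.
have alM : `|al| * M <= K by rewrite /K ler_wpM2r ?(ltW M0)// lerDl.
have beM : `|be| * M <= K by rewrite /K ler_wpM2r ?(ltW M0)// lerDr.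
have [rE lE] := sample_prob_ray t.
have [_ lE'] := sample_prob_ray (- t).
have K0 : 0 <= K by rewrite mulr_ge0 ?addr_ge0// ltW.
have mR : measurable (`]t, +oo[%classic : set R) by exact: measurable_itv.
have mL : measurable (`]-oo, (- t)]%classic : set R) by exact: measurable_itv.
split; rewrite -CE.
(* For [s = 1] this pattern is constantly false, so every observation is sent beyond [t]. *)
- have [mE pE] := sample_event_prob (n k) (fun l => (1 < s)%N && (l < k)%N) mA mR.
  apply: (markov_event iL mE r0); first by move: pE; rewrite rE.
  move=> w /sample_eventP Ew; rewrite /=; apply: r_le; rewrite /ga.
  have [s1|s1] := ltnP 1 s.
    apply: (@le_trans _ _ (`|be| * t - `|al| * M)).
      by rewrite lerB// ler_wpM2r ?(ltW t0)// ge_min lexx orbT.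
    apply: (lin_order_stat_right s1 k0 (ltW M0) Mt) => l ln.
    have := Ew l ln; rewrite s1 /=; case: ifP => _; rewrite /A/= in_itv//=.
    by rewrite andbT.
  have s1' : s = 1%N by apply/eqP; rewrite eqn_leq s1 s_gt0.
  apply: (@le_trans _ _ (`|al + be| * t)); first by rewrite gerBl.
  apply: lin_order_stat_median => //; left => l ln.
  by have := Ew l ln; rewrite s1' /= in_itv/= andbT.
- have [mE pE] := sample_event_prob (n k)
    (fun l => (1 < s)%N && ~~ (l < (s * k).-1)%N) mA mL.
  apply: (markov_event iL mE r0); first by move: pE; rewrite lE'.
  move=> w /sample_eventP Ew; rewrite /=; apply: r_le; rewrite /ga.
  have [s1|s1] := ltnP 1 s.
    apply: (@le_trans _ _ (`|al| * t - `|be| * M)).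
      by rewrite lerB// ler_wpM2r ?(ltW t0)// ge_min lexx.
    apply: (lin_order_stat_left s1 k0 (ltW M0) Mt) => l ln.
    by have := Ew l ln; rewrite s1 /=; case: ifP => _; rewrite /A/= in_itv.
  have s1' : s = 1%N by apply/eqP; rewrite eqn_leq s1 s_gt0.
  apply: (@le_trans _ _ (`|al + be| * t)); first by rewrite gerBl.
  apply: lin_order_stat_median => //; right => l ln.
  by have := Ew l ln; rewrite s1' /= in_itv.
Qed.

(* A common bound of both tails that stays positive: it is the maximum of the
   tails and [t^-1]. *)
Let tail_level_exists (g C M : R) (m : nat) (q1 q2 : R -> R) (b : R) :
  0 < g -> (0 < m)%N -> 0 < b <= 1 ->
  (forall t, M <= t -> (g * q1 t) ^+ m <= C / t /\ (g * q2 t) ^+ m <= C / t) ->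
  (forall t, M <= t -> q1 t <= b /\ q2 t <= b) ->
  forall t, Num.max M b^-1 <= t -> exists2 H : R, 0 < H <= b &
    [/\ q1 t <= H, q2 t <= H & (g * H) ^+ m <= Num.max C (g ^+ m) / t].
Proof.
move=> g0 m0 /andP[b0 b1] HC Hb t; rewrite ge_max => /andP[Mt bt].
have t1 : 1 <= t by rewrite (le_trans _ bt)// invf_ge1.
have t0 : 0 < t by exact: lt_le_trans t1.
have [h1 h2] := HC t Mt; have [h3 h4] := Hb t Mt.
have CC : C / t <= Num.max C (g ^+ m) / t.
  by rewrite ler_pM2r ?invr_gt0// le_max lexx.
have gC : (g * t^-1) ^+ m <= Num.max C (g ^+ m) / t.
  apply: (@le_trans _ _ (g ^+ m / t)); last first.
    by rewrite ler_pM2r ?invr_gt0// le_max lexx orbT.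
  rewrite exprMn ler_wpM2l ?exprn_ge0 ?(ltW g0)// exprVn lef_pV2 ?posrE ?exprn_gt0//.
  by rewrite -[leLHS]expr1 ler_weXn2l.
exists (Num.max (Num.max (q1 t) (q2 t)) t^-1).
  rewrite lt_max invr_gt0 t0 orbT /= !ge_max h3 h4 /=.
  by rewrite -[leRHS]invrK lef_pV2 ?posrE ?invr_gt0.
split; first by rewrite !le_max lexx.
  by rewrite !le_max lexx orbT.
case: (leP (Num.max (q1 t) (q2 t)) t^-1) => _ //.
by case: (leP (q1 t) (q2 t)) => _; apply: le_trans CC.
Qed.

Let rank_arith k j : (0 < k)%N -> (k <= j <= s * k)%N ->
  (0 < j <= n k)%N /\ (k + j <= (n k).+1)%N.
Proof. by clear; rewrite /n => k0 /andP[kj js]; split; nia. Qed.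

(** As [n k <= s.+1 * k], the exponential bound is at most [(B * H) ^+ k] with [B = 2 ^+ s.+1]. Once
    [B * H <= 1] and [k > 2 * m], it is at most [(B * H) ^+ (2 * m)], a constant times the square of
    [(g * H) ^+ m], which is [O(1 / t)]. *)
Lemma order_stat_tail_bound k0 : (0 < k0)%N -> P.-integrable setT (EFin \o L k0) ->
  exists C t0 : R, 0 < t0 /\ forall k j t, ((2 * n k0).+1 <= k)%N ->
    (k <= j <= s * k)%N -> t0 <= t ->
    (P [set w | t < `|order_stat X (n k) j w|]%R <= (C / t ^+ 2)%:E)%E.
Proof.
move=> k0_gt0 iL.
have [g [C [M [g0 M0 HC]]]] := integrable_tail_decay k0_gt0 iL.
have m0 : (0 < n k0)%N by rewrite /n; nia.
set m := n k0 in m0 HC *.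
pose B : R := 2 ^+ s.+1.
have B1 : 1 <= B by rewrite exprn_ege1// ler1n.
have B0 : 0 < B by exact: lt_le_trans B1.
have b01 : 0 < B^-1 <= 1 by rewrite invr_gt0 B0 invf_le1.
have b0 : 0 < B^-1 by rewrite invr_gt0.
have [M' M'0 HM'] := cdf_fun_tail_small b0.
pose C' := Num.max C (g ^+ m).
have HC' t : Num.max M M' <= t ->
    (g * (1 - F t)) ^+ m <= C / t /\ (g * F (- t)) ^+ m <= C / t.
  by rewrite ge_max => /andP[/HC].
have HM t : Num.max M M' <= t -> 1 - F t <= B^-1 /\ F (- t) <= B^-1.
  by rewrite ge_max => /andP[_ /HM'].
have level := tail_level_exists g0 m0 b01 HC' HM.
exists (2 * ((B / g) ^+ (2 * m) * C' ^+ 2)), (Num.max (Num.max M M') B^-1^-1).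
split; first by rewrite !lt_max M0.
move=> k j t mk kj tt; have [H /andP[H0 HB] [H1 H2 H3]] := level t tt.
have t0 : 0 < t by rewrite (lt_le_trans _ tt)// !lt_max M0.
have k0' : (0 < k)%N by exact: leq_ltn_trans (leq0n _) mk.
have [jn kjn] := rank_arith k0' kj.
have /andP[kj1 kj2] := kj.
have b1 : B^-1 <= 1 by case/andP: b01.
have H01 : 0 < H <= 1 by rewrite H0 (le_trans HB).
have U := order_stat_upper_tail jn kjn H1 H01.
have Lo := order_stat_lower_tail jn kj1 H2 H01.
have bound : 2 ^+ n k * H ^+ k <= (B / g) ^+ (2 * m) * C' ^+ 2 / t ^+ 2.
  have BH0 : 0 <= B * H by rewrite mulr_ge0// ltW.
  have BH1 : B * H <= 1 by rewrite mulrC -ler_pdivlMr// mul1r.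
  apply: (@le_trans _ _ ((B * H) ^+ k)).
    rewrite exprMn ler_wpM2r ?exprn_ge0 ?(ltW H0)// /B -exprM ler_weXn2l ?ler1n//.
    by rewrite /n leq_subr.
  apply: (@le_trans _ _ ((B * H) ^+ (2 * m))); first by rewrite ler_wiXn2l// ltnW.
  have -> : (B * H) ^+ (2 * m) = (B / g) ^+ (2 * m) * ((g * H) ^+ m) ^+ 2.
    rewrite -exprM (mulnC m) -exprMn; congr (_ ^+ _); field.
    by rewrite gt_eqF.
  rewrite -mulrA ler_wpM2l ?exprn_ge0 ?divr_ge0 ?(ltW B0) ?(ltW g0)//.
  have gH0 : 0 <= (g * H) ^+ m by rewrite exprn_ge0// mulr_ge0// ltW.
  by rewrite -expr_div_n lerXn2r ?nnegrE ?(le_trans gH0 H3).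
have mO := measurable_order_stat X (n k) j.
have mc (c : R) : measurable_fun [set: T] (fun=> c) by exact: measurable_cst.
have -> : 2 * ((B / g) ^+ (2 * m) * C' ^+ 2) / t ^+ 2
    = (B / g) ^+ (2 * m) * C' ^+ 2 / t ^+ 2 + (B / g) ^+ (2 * m) * C' ^+ 2 / t ^+ 2.
  by rewrite -mulrA mulr_natl mulr2n.
apply: (@prob_le_sum _ _ _ P _ [set w | t < order_stat X (n k) j w]
  [set w | order_stat X (n k) j w <= - t]).
- apply: (measurable_le_lt (mc t) _).2; exact: measurableT_comp.
- exact: (measurable_le_lt (mc t) mO).2.
- exact: (measurable_le_lt mO (mc _)).1.
- move=> w /=; rewrite lter_normr => /orP[h|h]; [by left|right].
  by rewrite /= lerNr ltW.
- by apply: (le_trans U); rewrite lee_fin.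
- by apply: (le_trans Lo); rewrite lee_fin.
Qed.

Lemma expectation_lin_order_stat (z y c e : R) : z <= y -> 0 < c -> 0 < e ->
  is_derive z 1 F c -> is_derive y 1 F e ->
  n k @[k --> \oo] --> \oo ->
  (forall k, `|(n k)%:R * F z - k%:R| <= 1) ->
  (forall k, `|(n k)%:R * F y - (s * k)%:R| <= 1) ->
  (\forall k \near \oo, P.-integrable setT (EFin \o L k)) ->
  'E_P[L k]%E @[k --> \oo] --> (al * z + be * y)%:E.
Proof.
move=> zy c0 e0 dz dy noo nz ny iL.
apply: expectation_cvg => //; first exact: measurable_L.
have i_n : \forall k \near \oo, (0 < k <= n k)%N.
  near=> k; have : (0 < k)%N by near: k; exact: nbhs_infty_gt.
  by rewrite /n; nia.
have j_n : \forall k \near \oo, (0 < s * k <= n k)%N.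
  near=> k; have : (0 < k)%N by near: k; exact: nbhs_infty_gt.
  by rewrite /n; nia.
have mO j k : measurable_fun setT (fun w => order_stat X (n k) (j k) w).
  exact: measurable_order_stat.
pose l := al * z + be * y.
have v : vanishes_in_prob P (fun k w => L k w - l).
  have v1 := order_stat_consistent X_indep X_cdf noo i_n c0 dz nz.
  have v2 := order_stat_consistent X_indep X_cdf noo j_n e0 dy ny.
  have := vanishesD _ _ (vanishesZ al v1) (vanishesZ be v2).
  set D := (D in vanishes_in_prob P D).
  rewrite (_ : D = fun k w => L k w - l); last first.
    by apply/funext => k; apply/funext => w; rewrite /D /L /l /lin_order_stat; ring.
  by apply => k; apply: measurable_funM => //; apply: measurable_funB => //; exact: mO.
(* A single integrable sample size suffices for the tails; [N.+1] is one with positive index. *)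
have [N _ HN] := iL.
have [|C [t0 [t0_gt0 HC]]] := @order_stat_tail_bound N.+1 (ltn0Sn N).
  by apply: HN => /=; exact: leqnSn.
pose a : R := `|al| + `|be|.
have a0 : 0 < a by rewrite ltr_pwDl ?normr_gt0.
(* If both order statistics are at most [t / (2 * a)] in absolute value, then [L k] is at most
   [t / 2], and [l] takes at most the other half. The two tails contribute [4 * a ^+ 2 * C / t ^+ 2]
   each. *)
apply: (@mean_abs_cvg0 _ _ _ _ _ (8 * a ^+ 2 * C) (Num.max (2 * `|l|) (2 * a * t0))
  (2 * n N.+1).+1) => //.
  move=> k; apply: measurable_funB => //; exact: measurable_L.
move=> k t Kk; rewrite ge_max => /andP[lt at0].
have t2a : t0 <= t / (2 * a) by rewrite ler_pdivlMr ?mulr_gt0// mulrC.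
have kk : (k <= k <= s * k)%N by rewrite leqnn leq_pmull.
have skk : (k <= s * k <= s * k)%N by rewrite leqnn leq_pmull.
have t_gt0 : 0 < t by rewrite (lt_le_trans _ at0)// !mulr_gt0.
have h1 := HC k k _ Kk kk t2a; have h2 := HC k (s * k)%N _ Kk skk t2a.
have -> : 8 * a ^+ 2 * C / t ^+ 2 = C / (t / (2 * a)) ^+ 2 + C / (t / (2 * a)) ^+ 2.
  by field; rewrite !gt_eqF.
have mc (x : R) : measurable_fun [set: T] (fun=> x) by exact: measurable_cst.
apply: (prob_le_sum _ _ _ _ h1 h2).
- apply: (measurable_le_lt (mc t) _).2; apply: measurableT_comp => //.
  by apply: measurable_funB => //; exact: measurable_L.
- by apply: (measurable_le_lt (mc _) _).2; apply: measurableT_comp => //; exact: mO.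
- by apply: (measurable_le_lt (mc _) _).2; apply: measurableT_comp => //; exact: mO.
move=> w /= tL.
have [h|h] := ltP (t / (2 * a)) `|order_stat X (n k) k w|; [by left|right].
rewrite /= ltNge; apply/negP => h'.
have : `|L k w - l| <= `|al| * (t / (2 * a)) + `|be| * (t / (2 * a)) + `|l|.
  rewrite (le_trans (ler_normB _ _))// lerD2r (le_trans (ler_normD _ _))//.
  by rewrite !normrM lerD// ler_wpM2l.
rewrite -mulrDl -/a (_ : a * (t / (2 * a)) = t / 2); last by field; rewrite gt_eqF.
by move=> h''; lra.
Unshelve. all: by end_near. Qed.

End Tails.

(** * Fences *)

Section Fences.
Context {R : realType} {d : measure_display} {T : measurableType d}.
Context {P : probability T R}.
Variable X : nat -> {RV P >-> R}.
Variable F : R -> R.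
Hypothesis X_indep : mutually_independent X.
Hypothesis X_cdf : forall i x, cdf (X i) x = (F x)%:E.

Lemma has_inf_quantile (q : R) : 0 < q < 1 -> has_inf [set x | q <= F x].
Proof.
move=> /andP[q0 q1]; split.
  have q1' : 0 < 1 - q by lra.
  have [M _ HM] := cdf_fun_tail_small X_cdf q1'.
  by exists M => /=; have [h _] := HM M (lexx _); lra.
have q2 : 0 < q / 2 by lra.
have [M _ HM] := cdf_fun_tail_small X_cdf q2.
exists (- M) => x /= qx; rewrite leNgt; apply/negP => /ltW xM.
have := cdf_fun_homo X_cdf xM; have [_ h] := HM M (lexx _).
by lra.
Qed.

Lemma quantile_le (q x : R) : 0 < q < 1 -> q <= F x -> quantile F q <= x.
Proof. by move=> q01 qx; apply: ge_inf => //; case: (has_inf_quantile q01). Qed.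

(** Left of the quantile [F] is below [q], right of it at least [q]; derivability gives the
    continuity that joins the two. *)
Lemma cdf_quantile (q : R) : 0 < q < 1 -> derivable F (quantile F q) 1 ->
  F (quantile F q) = q.
Proof.
move=> q01 dF; set z := quantile F q in dF *.
have cF : F x @[x --> z] --> F z.
  by apply: differentiable_continuous; apply/derivable1_diffP.
apply/eqP; rewrite eq_le; apply/andP; split.
  apply: (cvgr_to_le (cvg_at_left_filter cF)).
  near=> x; apply: ltW; rewrite ltNge; apply/negP => /(quantile_le q01).
  by rewrite leNgt => /negP; apply; near: x; exact: nbhs_left_lt.
apply: (cvgr_to_ge (cvg_at_right_filter cF)).
near=> x; have zx : z < x by near: x; exact: nbhs_right_gt.
have [|u /= qu ux] := @inf_adherent _ _ (x - z) _ (has_inf_quantile q01).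
  by rewrite subr_gt0.
apply: (le_trans qu); apply: (cdf_fun_homo X_cdf); apply: ltW.
by move: ux; rewrite -/(quantile F q) -/z addrC subrK.
Unshelve. all: by end_near. Qed.

Variables (s : nat) (al be c e : R).
Hypotheses (s_gt0 : (0 < s)%N) (al_neq0 : al != 0) (be_neq0 : be != 0).
Hypothesis albe_neq0 : al + be != 0.
Let p : R := s.+1%:R^-1.
Let q : R := s%:R / s.+1%:R.
Let z := quantile F p.
Let y := quantile F q.
Let n k := (s.+1 * k - 1)%N.
Hypotheses (c_gt0 : 0 < c) (e_gt0 : 0 < e) (ce : s = 1%N -> c = e).
Hypotheses (dFz : is_derive z 1 F c) (dFy : is_derive y 1 F e).

Let s0 : 0 < s%:R :> R. Proof. by rewrite ltr0n. Qed.
Let p01 : 0 < p < 1.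
Proof. by rewrite invr_gt0 ltr0n/= invf_lt1 ?ltr0n// ltr1n ltnS. Qed.
Let q01 : 0 < q < 1.
Proof.
rewrite divr_gt0 ?ltr0n//= ltr_pdivrMr ?ltr0n// mul1r ltr_nat.
exact: ltnSn.
Qed.
Let Fz : F z = p. Proof. by apply: cdf_quantile => //; case: dFz. Qed.
Let Fy : F y = q. Proof. by apply: cdf_quantile => //; case: dFy. Qed.
Let zy : z <= y.
Proof.
apply: quantile_le => //; rewrite Fy /p /q -[leLHS]mul1r.
by rewrite ler_pM2r ?invr_gt0 ?ltr0n// ler1n.
Qed.
Let noo : n k @[k --> \oo] --> \oo.
Proof.
move=> A [N _ NA]; exists N.+1 => // k /= Nk; apply: NA => /=.
by clear -Nk s_gt0; rewrite /n; nia.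
Qed.
Let nE k : (0 < k)%N -> (n k)%:R = s.+1%:R * k%:R - 1 :> R.
Proof. by move=> k0; rewrite /n natrB ?natrM// muln_gt0. Qed.
(** For [k > 0] the difference is exactly [- r], the effect of the [- 1] in the sample size; at
    [k = 0] truncated subtraction makes both terms 0. *)
Let nF k (j : nat) (r : R) : 0 <= r <= 1 -> s.+1%:R * r = j%:R ->
  `|(n k)%:R * r - (j * k)%:R| <= 1.
Proof.
move=> /andP[r0 r1] rj; have [->|k0] := posnP k.
  by rewrite /n muln0 sub0n muln0 mul0r subr0 normr0.
rewrite nE// (_ : _ - _ = - r); last by rewrite natrM -rj; ring.
by rewrite normrN ger0_norm.
Qed.
Let nz k : `|(n k)%:R * F z - k%:R| <= 1.
Proof.
have := @nF k 1 (F z); rewrite mul1n; apply.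
  exact: (cdf_fun_itv X_cdf).
by rewrite Fz divff// pnatr_eq0.
Qed.
Let ny k : `|(n k)%:R * F y - (s * k)%:R| <= 1.
Proof.
apply: nF; first exact: (cdf_fun_itv X_cdf).
by rewrite Fy /q mulrC divfK// pnatr_eq0.
Qed.

(** Both indicators have variance [s / (s + 1) ^+ 2] and their covariance is [1 / (s + 1) ^+ 2],
    whence the [s] in the last denominator. *)
Definition fence_var : R := s%:R / s.+1%:R ^+ 2 *
  ((al / c) ^+ 2 + (be / e) ^+ 2 + 2 * al * be / (s%:R * c * e)).

Let fence_varE : lin_var F z y c e al be = fence_var.
Proof.
rewrite /lin_var Fz Fy /p /q /fence_var -natr1; field.
by rewrite ?gt_eqF ?ltr_wpDl// ltW.
Qed.

(** A sum of squares: for [s > 1] the first part is positive; for [s = 1] it vanishes, and [c = e]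
    with [al + be != 0] keeps the second positive. *)
Let fence_var_gt0 : 0 < fence_var.
Proof.
have -> : fence_var = ((s%:R - 1) * ((al / c) ^+ 2 + (be / e) ^+ 2)
    + (al / c + be / e) ^+ 2) / s.+1%:R ^+ 2.
  rewrite /fence_var -natr1; field.
  by rewrite ?gt_eqF ?ltr_wpDl// ltW.
rewrite divr_gt0 ?exprn_gt0 ?ltr0n//.
have [s1|s1] := ltnP 1 s.
  rewrite ltr_pwDl ?sqr_ge0// mulr_gt0 ?subr_gt0 ?ltr1n//.
  by rewrite ltr_pwDl ?sqr_ge0// exprn_even_gt0//= mulf_neq0// invr_neq0// gt_eqF.
have s1' : s = 1%N by apply/eqP; rewrite eqn_leq s1 s_gt0.
rewrite s1' subrr mul0r add0r exprn_even_gt0//= (ce s1') -mulrDl.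
by rewrite mulf_neq0// invr_neq0// gt_eqF.
Qed.

Variable L : nat -> T -> R.
Hypothesis LE : forall k, (0 < k)%N ->
  L k = lin_order_stat X n id (fun k => s * k)%N al be k.

Let near_L : \forall k \near \oo,
  lin_order_stat X n id (fun k => s * k)%N al be k = L k.
Proof. by near=> k; rewrite LE//; near: k; exact: nbhs_infty_gt.
Unshelve. all: by end_near. Qed.

Lemma expectation_fence : (\forall k \near \oo, P.-integrable setT (EFin \o L k)) ->
  'E_P[L k]%E @[k --> \oo] --> (al * z + be * y)%:E.
Proof.
move=> iL; apply: cvg_trans (expectation_lin_order_stat X_indep X_cdf s_gt0
  al_neq0 be_neq0 albe_neq0 zy c_gt0 e_gt0 dFz dFy noo nz ny _).
  by apply: near_eq_cvg; near do congr expectation.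
by apply: filterS2 near_L iL => k ->.
Unshelve. all: by end_near. Qed.

Lemma cvg_law_fence : cvg_in_law (P := P)
  (fun k w => Num.sqrt (n k)%:R * (L k w - (al * z + be * y)))
  (gaussian 0 fence_var).
Proof.
move=> x _; rewrite /gaussian -fence_varE.
have i_n : \forall k \near \oo, (0 < k <= n k)%N.
  near=> k; have : (0 < k)%N by near: k; exact: nbhs_infty_gt.
  by clear -s_gt0; rewrite /n; nia.
have j_n : \forall k \near \oo, (0 < s * k <= n k)%N.
  near=> k; have : (0 < k)%N by near: k; exact: nbhs_infty_gt.
  by clear -s_gt0; rewrite /n; nia.
apply: cvg_trans (@cvg_law_lin_order_stat _ _ _ P X F X_indep X_cdf n id
  (fun k => s * k)%N noo i_n j_n z y c e zy c_gt0 e_gt0 dFz dFy nz ny al be x _).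
  by apply: near_eq_cvg; apply: filterS near_L => k ->.
by rewrite fence_varE fence_var_gt0.
Unshelve. all: by end_near. Qed.

(** The sample size is chosen so that [(n k).+1 * r] is the integer [j * k], and taking the integer
    part loses nothing. *)
Lemma emp_quantileE k j (r : R) : (0 < k)%N -> s.+1%:R * r = j%:R ->
  emp_quantile X (n k) r = order_stat X (n k) (j * k).
Proof.
move=> k0 rj; rewrite /emp_quantile; congr order_stat.
have -> : (n k).+1%:R * r = (j * k)%:R.
  by rewrite -natr1 nE// subrK natrM -rj mulrAC.
by rewrite natrK.
Qed.

End Fences.

Theorem theorem5 (R : realType) (d : measure_display) (T : measurableType d)
    (P : probability T R) (X : nat -> {RV P >-> R}) (F f : R -> R) (s : nat)
    (s_gt0 : (0 < s)%N)
    (X_indep : mutually_independent X)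
    (X_cdf : forall i x, cdf (X i) x = (F x)%:E)
    (f_pdf : is_pdf F f)
    (cF_ex : derivable F (quantile F (s.+1%:R^-1)) 1)
    (cF_gt0 : 0 < f (quantile F (s.+1%:R^-1)))
    (dF_ex : derivable F (quantile F (s%:R / s.+1%:R)) 1)
    (dF_gt0 : 0 < f (quantile F (s%:R / s.+1%:R))) :
  let p : R := s.+1%:R^-1 in
  let cF : R := f (quantile F (s.+1%:R^-1)) in
  let dF : R := f (quantile F (s%:R / s.+1%:R)) in
  let n k := (s.+1 * k - 1)%N in
  let Ln k := emp_lfence X (n k) p in
  let Rn k := emp_rfence X (n k) p in
  [/\ (\forall k \near \oo, P.-integrable setT (EFin \o Ln k)) ->
        'E_P[Ln k]%E @[k --> \oo] --> (lfence F p)%:E,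
      (\forall k \near \oo, P.-integrable setT (EFin \o Rn k)) ->
        'E_P[Rn k]%E @[k --> \oo] --> (rfence F p)%:E,
      cvg_in_law (P := P)
        (fun k w => Num.sqrt (n k)%:R * (Ln k w - lfence F p))
        (gaussian 0 (lfence_var s cF dF))
    & cvg_in_law (P := P)
        (fun k w => Num.sqrt (n k)%:R * (Rn k w - rfence F p))
        (gaussian 0 (rfence_var s cF dF))].
Proof.
move=> p cF dF n Ln Rn.
have [_ _ _ f_der] := f_pdf.
(* The version of the density fixed in [is_pdf] equals the derivative of [F] at the two
   quantiles. *)
have dz : is_derive (quantile F (s.+1%:R^-1)) 1 F cF.
  by rewrite /cF -f_der// derive1E; exact: derivableP.
have dy : is_derive (quantile F (s%:R / s.+1%:R)) 1 F dF.
  by rewrite /dF -f_der// derive1E; exact: derivableP.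
have s0 : 0 < s%:R :> R by rewrite ltr0n.
have s1 : 0 < s.+1%:R :> R by rewrite ltr0n.
have sE : s.+1%:R = s%:R + 1 :> R by rewrite -natr1.
have pV : p^-1 = s.+1%:R by rewrite /p invrK.
have q_p : 1 - p = s%:R / s.+1%:R by rewrite /p sE; field; rewrite gt_eqF// -sE.
have qp_ratio : (1 - p) / p = s%:R by rewrite q_p pV divfK// gt_eqF.
(* Both quantiles are then the median. *)
have ce : s = 1%N -> cF = dF by rewrite /cF /dF => ->; rewrite mul1r.
have Np : s.+1%:R * p = 1%:R by rewrite divff// gt_eqF.
have Nq : s.+1%:R * (1 - p) = s%:R by rewrite q_p mulrC divfK// gt_eqF.
have LnE k : (0 < k)%N ->
    Ln k = lin_order_stat X n id (fun k => s * k)%N s.+1%:R (- s%:R) k.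
  move=> k0; apply/funext => w; rewrite /Ln /emp_lfence qp_ratio pV.
  rewrite (emp_quantileE X k0 Np) (emp_quantileE X k0 Nq).
  by rewrite mul1n /lin_order_stat mulNr.
have RnE k : (0 < k)%N ->
    Rn k = lin_order_stat X n id (fun k => s * k)%N (- s%:R) s.+1%:R k.
  move=> k0; apply/funext => w; rewrite /Rn /emp_rfence qp_ratio pV.
  rewrite (emp_quantileE X k0 Np) (emp_quantileE X k0 Nq).
  by rewrite mul1n /lin_order_stat mulNr addrC.
have lfE : lfence F p = s.+1%:R * quantile F p + - s%:R * quantile F (s%:R / s.+1%:R).
  by rewrite /lfence qp_ratio pV q_p mulNr.
have rfE : rfence F p = - s%:R * quantile F p + s.+1%:R * quantile F (s%:R / s.+1%:R).
  by rewrite /rfence qp_ratio pV q_p mulNr addrC.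
have lvE : lfence_var s cF dF = fence_var s s.+1%:R (- s%:R) cF dF.
  rewrite /lfence_var /fence_var; field.
  by rewrite ?gt_eqF.
have rvE : rfence_var s cF dF = fence_var s (- s%:R) s.+1%:R cF dF.
  rewrite /rfence_var /fence_var; field.
  by rewrite ?gt_eqF.
have s_neq0 : - s%:R != 0 :> R by rewrite oppr_eq0 gt_eqF.
have s1_neq0 : s.+1%:R != 0 :> R by rewrite gt_eqF.
(* The coefficients of either fence sum to 1, which excludes cancellation at the median. *)
have sum1 : s.+1%:R + - s%:R != 0 :> R by rewrite sE addrAC subrr add0r oner_eq0.
have sum1' : - s%:R + s.+1%:R != 0 :> R by rewrite addrC.
rewrite lfE rfE lvE rvE; split.
- exact: (expectation_fence X_indep X_cdf s_gt0 s1_neq0 s_neq0 sum1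
    cF_gt0 dF_gt0 dz dy LnE).
- exact: (expectation_fence X_indep X_cdf s_gt0 s_neq0 s1_neq0 sum1'
    cF_gt0 dF_gt0 dz dy RnE).
- exact: (cvg_law_fence X_indep X_cdf s_gt0 s1_neq0 sum1 cF_gt0 dF_gt0 ce dz dy LnE).
- exact: (cvg_law_fence X_indep X_cdf s_gt0 s_neq0 sum1' cF_gt0 dF_gt0 ce dz dy RnE).
Qed.
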